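(* Let $(\mathcal A,\varphi)$ be a noncommutative probability space over a commutative ring $\mathbb K$, let $I$ be an index set, let $(X_i)_{i\in I}$ be elements of $\mathcal A$, and let $\boldsymbol{\tau}\colon\mathsf{BPT}(I)\to\mathbb K$ be a weighted troupe. The following are equivalent: (i) for all $n\ge1$ and all $i_1,\dots,i_n\in I$, $-K_n(X_{i_1},\dots,X_{i_n})=\sum_{T\in\mathsf{DBPT}(i_1,\dots,i_n)}\boldsymbol{\tau}(T)$; (ii) for all $n\ge1$ and all $i_1,\dots,i_n\in I$, $-R_n(X_{i_1},\dots,X_{i_n})=\sum_{T\in\mathsf{BPT}(i_1,\dots,i_n)}\boldsymbol{\tau}(T)$; (iii) for all $n\ge1$ and all $i_1,\dots,i_n\in I$, $-B_n(X_{i_1},\dots,X_{i_n})=\sum_{T\in\mathsf{Branch}(i_1,\dots,i_n)}\boldsymbol{\tau}(T)$.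
   Context: A noncommutative probability space over $\mathbb K$ is a pair $(\mathcal A,\varphi)$ where $\mathcal A$ is a unital associative $\mathbb K$-algebra and $\varphi\colon\mathcal A\to\mathbb K$ is a $\mathbb K$-linear map with $\varphi(1)=1$. For $n\ge1$, the classical, free and Boolean cumulants $K_n,R_n,B_n\colon\mathcal A^n\to\mathbb K$ are the unique multilinear functionals such that for all $n\ge1$ and $X_1,\dots,X_n\in\mathcal A$: $\varphi(X_1\cdots X_n)=\sum_{\pi\in\Pi(n)}K_\pi=\sum_{\pi\in\mathrm{NC}(n)}R_\pi=\sum_{\pi\in\mathrm{Int}(n)}B_\pi$, where $\Pi(n)$ is the set of all set partitions of $[n]=\{1,\dots,n\}$; $\mathrm{NC}(n)$ is the set of noncrossing ones (no $a<b<c<d$ with $a,c$ in one block and $b,d$ in a different block); $\mathrm{Int}(n)$ is the set of interval partitions (every block is a set of consecutive integers); and $K_\pi=\prod_{U\in\pi}K_U$, where for $U=\{u_1<\dots<u_k\}$, $K_U=K_k(X_{u_1},\dots,X_{u_k})$ (similarly $R_\pi$, $B_\pi$). A binary plane tree is a rooted tree in which each child of a vertex is a left child or a right child, no vertex having more than one of each; trees are up to isomorphism and the empty tree $\varnothing$ is allowed. A branch is a nonempty binary plane tree in which every vertex has at most one child. Postorder on a tree: for each vertex $v$, all vertices of its left subtree precede all vertices of its right subtree, which precede $v$. Let $\boxminus$ be a special symbol. An $I$-coloring of a tree $T$ is a function $\chi\colon T\sqcup\{\boxminus\}\to I$; $\mathsf{BPT}(I)$ is the set of $I$-colored binary plane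 trees (including $\varnothing$). For $i_1,\dots,i_n\in I$: $\mathsf{BPT}(i_1,\dots,i_n)$ is the set of $I$-colored binary plane trees with $n-1$ vertices whose vertex colors read in postorder are $i_1,\dots,i_{n-1}$ and with $\chi(\boxminus)=i_n$; $\mathsf{Branch}(i_1,\dots,i_n)$ is the set of branches in $\mathsf{BPT}(i_1,\dots,i_n)$; $\mathsf{DBPT}(i_1,\dots,i_n)$ is the set of $I$-colored binary plane trees $T$ with $n-1$ vertices equipped with a decreasing standard labeling $\mathcal L\colon T\to[n-1]$ (a bijection with each vertex's label larger than its children's labels) such that $\chi(v)=i_{\mathcal L(v)}$ for all vertices $v$ and $\chi(\boxminus)=i_n$; two such labeled trees are identified iff there is a label- and color-preserving isomorphism. For $T\in\mathsf{DBPT}(i_1,\dots,i_n)$, $\boldsymbol{\tau}(T)$ means $\boldsymbol{\tau}$ of the underlying $I$-colored tree. Insertion: for nonempty $I$-colored trees $T_1,T_2$ with colorings $\chi_1,\chi_2$ and a vertex $v$ of $T_1$, $\nabla_v(T_1,T_2)$ is formed by creating a new vertex $v^*$ taking the place of $v$ in $T_1$, making $v$ (with its subtrees) the left child of $v^*$, and attaching $T_2$ as the right subtree of $v^*$; the coloring is $\chi_1$ on $T_1\sqcup\{\boxminus\}$, $\chi_2$ on vertices of $T_2$, and $v^*$ gets color $\chi_2(\boxminus)$. A weighted troupe is a function $\boldsymbol{\tau}\colon\mathsf{BPT}(I)\to\mathbb K$ with $\boldsymbol{\tau}(\varnothing)=0$ and $\boldsymbol{\tau}(\nabla_v(T_1,T_2))=\boldsymbol{\tau}(T_1)\boldsymbol{\tau}(T_2)$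 for all nonempty $T_1,T_2$ and vertices $v$ of $T_1$. *)

(* Defs.v *)
From HB Require Import structures.
From mathcomp Require Import all_boot all_order all_algebra.
Set Implicit Arguments. Unset Strict Implicit. Unset Printing Implicit Defensive.
Import GRing.Theory.
Local Open Scope ring_scope.

Definition noncrossing n (P : {set {set 'I_n}}) : bool :=
  [forall U in P, forall V in P, (U != V) ==>
     [forall a : 'I_n, forall b : 'I_n, forall c : 'I_n, forall d : 'I_n,
        ~~ [&& (a < b)%N, (b < c)%N, (c < d)%N,
               a \in U, c \in U, b \in V & d \in V]]].

Definition interval_partition n (P : {set {set 'I_n}}) : bool :=
  [forall U in P, forall a : 'I_n, forall b : 'I_n, forall c : 'I_n,
     [&& (a < b)%N, (b < c)%N, a \in U & c \in U] ==> (b \in U)].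

Definition moment_cumulant_rel (K : comNzRingType) (A : algType K)
  (phi : A -> K) (C : seq A -> K)
  (adm : forall n, {set {set 'I_n}} -> bool) : Prop :=
  forall n, (0 < n)%N -> forall X : 'I_n -> A,
    phi (\prod_(i < n) X i) =
    \sum_(P : {set {set 'I_n}} | partition P [set: 'I_n] && adm n P)
       \prod_(U in P) C [seq X u | u in U].

Definition classical_cumulants K A phi C :=
  @moment_cumulant_rel K A phi C (fun n _ => true).
Definition free_cumulants K A phi C :=
  @moment_cumulant_rel K A phi C noncrossing.
Definition boolean_cumulants K A phi C :=
  @moment_cumulant_rel K A phi C interval_partition.

(* A binary plane tree whose vertices carry labels in T (up to isomorphism,
   binary plane trees are exactly the terms of this inductive type). *)
Inductive bptree (T : Type) : Type :=
  | BLeaf : bptree T                                  (* empty tree *)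
  | BNode : bptree T -> T -> bptree T -> bptree T.
Arguments BLeaf {T}.

Definition nonempty T (t : bptree T) : bool := if t is BNode _ _ _ then true else false.

Fixpoint postorder T (t : bptree T) : seq T :=
  match t with
  | BLeaf => [::]
  | BNode l c r => postorder l ++ postorder r ++ [:: c]
  end.

Fixpoint tmap T U (f : T -> U) (t : bptree T) : bptree U :=
  match t with
  | BLeaf => BLeaf
  | BNode l c r => BNode (tmap f l) (f c) (tmap f r)
  end.

(* all trees whose vertex labels read in postorder give s (fuel = size s) *)
Fixpoint bpts_fuel T (f : nat) (s : seq T) : seq (bptree T) :=
  match s with
  | [::] => [:: BLeaf]
  | x :: s0 =>
    match f with
    | 0 => [::]
    | f'.+1 =>
      let c := last x s0 in
      let s' := belast x s0 in
      flatten [seq [seq BNode l c r | l <- bpts_fuel f' (take k s'),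
                                      r <- bpts_fuel f' (drop k s')]
              | k <- iota 0 (size s').+1]
    end
  end.

Definition bpts T (s : seq T) : seq (bptree T) := bpts_fuel (size s) s.

Fixpoint chain T (t : bptree T) : bool :=
  match t with
  | BLeaf => true
  | BNode l _ r => (~~ nonempty l || ~~ nonempty r) && chain l && chain r
  end.

Definition is_branch T (t : bptree T) : bool := nonempty t && chain t.

Definition child_lt (a : nat) (t : bptree nat) : bool :=
  if t is BNode _ b _ then (b < a)%N else true.

Fixpoint decreasing (t : bptree nat) : bool :=
  match t with
  | BLeaf => true
  | BNode l a r => [&& child_lt a l, child_lt a r, decreasing l & decreasing r]
  end.

(* an I-colored binary plane tree: the tree with vertex colors, together with
   the color chi(boxminus) of the special symbol *)
Definition cbpt (I : Type) := (bptree I * I)%type.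

Fixpoint is_vertex T (t : bptree T) (p : seq bool) : bool :=
  match t, p with
  | BLeaf, _ => false
  | BNode _ _ _, [::] => true
  | BNode l _ _, false :: p' => is_vertex l p'
  | BNode _ _ r, true :: p' => is_vertex r p'
  end.

Fixpoint graft T (t : bptree T) (p : seq bool) (t2 : bptree T) (c : T) : bptree T :=
  match t, p with
  | BLeaf, _ => BLeaf
  | BNode _ _ _, [::] => BNode t c t2
  | BNode l a r, false :: p' => BNode (graft l p' t2 c) a r
  | BNode l a r, true :: p' => BNode l a (graft r p' t2 c)
  end.

Definition nabla I (T1 : cbpt I) (v : seq bool) (T2 : cbpt I) : cbpt I :=
  (graft T1.1 v T2.1 T2.2, T1.2).

Definition weighted_troupe (K : comNzRingType) (I : Type) (tau : cbpt I -> K) : Prop :=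
  (forall i : I, tau (BLeaf, i) = 0) /\
  (forall (T1 T2 : cbpt I) (v : seq bool),
      nonempty T1.1 -> nonempty T2.1 -> is_vertex T1.1 v ->
      tau (nabla T1 v T2) = tau T1 * tau T2).

(* Sums over BPT(i_1..i_n), Branch(i_1..i_n), DBPT(i_1..i_n), where
   s = [:: i_1; ...; i_{n-1}] and j = i_n. *)
Definition sum_BPT (K : comNzRingType) I (tau : cbpt I -> K) (s : seq I) (j : I) : K :=
  \sum_(t <- bpts s) tau (t, j).

Definition sum_Branch (K : comNzRingType) I (tau : cbpt I -> K) (s : seq I) (j : I) : K :=
  \sum_(t <- bpts s | is_branch t) tau (t, j).

(* decreasing standard labelings use labels 0..n-2 (label l stands for l+1);
   a labelled plane tree is enumerated once via its postorder label word,
   which ranges over the permutations of the label set; the vertex with label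
   l gets color i_{l+1} = nth j s l. *)
Definition sum_DBPT (K : comNzRingType) I (tau : cbpt I -> K) (s : seq I) (j : I) : K :=
  \sum_(w <- permutations (iota 0 (size s)))
     \sum_(t <- bpts w | decreasing t) tau (tmap (nth j s) t, j).

(* Main.v *)
(** Let [m] be the moment of a word. Summing over the block of the last letter [x],
[m (w x) = L_m (C (- x)) w], where [L_m] is a shuffle, gap or cut convolution with [m]
in the classical, free or Boolean case. So each of the three conditions says that
[m (w x) = - L_m (E_x) w], with [E_x w] the sum of [tau] over the trees of that kind.
For a functional [c] on trees with [c (nabla_v (t1, t2)) = c t1 * tau t2], let [E_c w] be
its sum over trees. Peeling the last letter off [L_m (E_c)], the trees whose root has two
children cancel against the expansion of [m], and what remains is a recursion on words
that is the same for the three kinds. Hence each condition is equivalent to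
[m] being given by this recursion. *)
Require Import Defs.
From HB Require Import structures.
From mathcomp Require Import all_boot all_order all_algebra.
From mathcomp Require Import ring.
Set Implicit Arguments. Unset Strict Implicit. Unset Printing Implicit Defensive.
Import GRing.Theory.
Local Open Scope ring_scope.

(** * Convolutions of functions on words *)

Section Convolutions.
Variables (K : comNzRingType) (T : Type).
Implicit Types (f g h m : seq T -> K) (w u v : seq T) (x : T).

(** The induction cannot stay with [tau] alone. Removing a root with a single child replaces the
    tree by that child and [tau] by a functional such as [fun t => tau (BNode t x BLeaf, j)], which
    in general is not a troupe. What survives is multiplicativity for insertions into [t], because a
    vertex of the child is also a vertex of the whole tree; hence the property asked of [c]. A root
    with two children is itself an insertion, of its right subtree at the root of its left subtree,
    so it factors. In the classical and free cases the cancellation of these roots uses the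
    expansion of [m] at shorter words. The way back from the common recursion to each condition is
    therefore an induction on length. On the partition side, letters may repeat while blocks are
    sets of positions. Words are lifted to decreasing lists of positions in one ordinal, so that
    subwords become subsets and one block weight serves all of them. *)

Definition shift x f : seq T -> K := fun u => f (x :: u).

Fixpoint splits w : seq (seq T * seq T) :=
  if w is x :: w' then
    [seq (x :: p.1, p.2) | p <- splits w'] ++ [seq (p.1, x :: p.2) | p <- splits w']
  else [:: ([::], [::])].

Fixpoint cuts w : seq (seq T * seq T) :=
  ([::], w) :: if w is x :: w' then [seq (x :: p.1, p.2) | p <- cuts w'] else [::].

Definition shuffle_conv f g w : K := \sum_(p <- splits w) f p.1 * g p.2.
Definition cut_conv f g w : K := \sum_(p <- cuts w) f p.1 * g p.2.

(* Words are read from their last letter to their first, which is the head of [w].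
   The letters of [w] not selected for [f] form gaps, each weighted by [m],
   except the first one, which is weighted by [g]. *)
Fixpoint gap_conv m f g w : K :=
  if w is x :: w' then
    g [::] * gap_conv m (shift x f) m w' + gap_conv m f (shift x g) w'
  else f [::] * g [::].

Lemma shuffle_conv_nil f g : shuffle_conv f g [::] = f [::] * g [::].
Proof. by rewrite /shuffle_conv big_seq1. Qed.

Lemma shuffle_conv_cons f g x w :
  shuffle_conv f g (x :: w) = shuffle_conv (shift x f) g w + shuffle_conv f (shift x g) w.
Proof. by rewrite /shuffle_conv /= big_cat !big_map. Qed.

Lemma cut_conv_nil f g : cut_conv f g [::] = f [::] * g [::].
Proof. by rewrite /cut_conv big_seq1. Qed.

Lemma cut_conv_cons f g x w :
  cut_conv f g (x :: w) = f [::] * g (x :: w) + cut_conv (shift x f) g w.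
Proof. by rewrite /cut_conv /= big_cons big_map. Qed.

Lemma eq_shuffle_conv f f' g g' w :
  (forall u, (size u <= size w)%N -> f u = f' u) ->
  (forall u, (size u <= size w)%N -> g u = g' u) ->
  shuffle_conv f g w = shuffle_conv f' g' w.
Proof.
elim: w f f' g g' => [|x w IH] f f' g g' ef eg.
  by rewrite !shuffle_conv_nil ef // eg.
rewrite !shuffle_conv_cons; congr (_ + _); apply: IH => u hu;
  by [apply: ef | apply: eg | apply: ef (leqW hu) | apply: eg (leqW hu)].
Qed.

Lemma eq_cut_conv f f' g g' w :
  (forall u, (size u <= size w)%N -> f u = f' u) ->
  (forall u, (size u <= size w)%N -> g u = g' u) ->
  cut_conv f g w = cut_conv f' g' w.
Proof.
elim: w f f' => [|x w IH] f f' ef eg.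
  by rewrite !cut_conv_nil ef // eg.
rewrite !cut_conv_cons ef // eg //; congr (_ + _); apply: IH => u hu;
  by [apply: ef | apply: eg (leqW hu)].
Qed.

Lemma eq_gap_conv m f f' g g' w :
  (forall u, (size u <= size w)%N -> f u = f' u) ->
  (forall u, (size u <= size w)%N -> g u = g' u) ->
  gap_conv m f g w = gap_conv m f' g' w.
Proof.
elim: w f f' g g' => [|x w IH] f f' g g' ef eg /=; first by rewrite ef ?eg.
by rewrite eg //; congr (_ * _ + _); apply: IH => u hu //;
  [apply: ef | apply: ef (leqW hu) | apply: eg].
Qed.

Lemma shuffle_conv_linearl a f f' g w :
  shuffle_conv (fun u => a * f u + f' u) g w = a * shuffle_conv f g w + shuffle_conv f' g w.
Proof. by rewrite /shuffle_conv mulr_sumr -big_split; apply: eq_bigr => p _ /=; ring. Qed.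

Lemma cut_conv_linearl a f f' g w :
  cut_conv (fun u => a * f u + f' u) g w = a * cut_conv f g w + cut_conv f' g w.
Proof. by rewrite /cut_conv mulr_sumr -big_split; apply: eq_bigr => p _ /=; ring. Qed.

Lemma gap_conv_linearl m a f f' g w :
  gap_conv m (fun u => a * f u + f' u) g w = a * gap_conv m f g w + gap_conv m f' g w.
Proof.
elim: w f f' g => [|x w IH] f f' g /=; first by ring.
by rewrite (IH (shift x f) (shift x f')) IH; ring.
Qed.

Lemma gap_conv_linearr m a f g g' w :
  gap_conv m f (fun u => a * g u + g' u) w = a * gap_conv m f g w + gap_conv m f g' w.
Proof.
elim: w f g g' => [|x w IH] f g g' /=; first by ring.
by rewrite (IH f (shift x g) (shift x g')); ring.
Qed.

Lemma shuffle_conv_linearr a f g g' w :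
  shuffle_conv f (fun u => a * g u + g' u) w = a * shuffle_conv f g w + shuffle_conv f g' w.
Proof. by rewrite /shuffle_conv mulr_sumr -big_split; apply: eq_bigr => p _ /=; ring. Qed.

Lemma shuffle_convA f g h w :
  shuffle_conv f (shuffle_conv g h) w = shuffle_conv (shuffle_conv f g) h w.
Proof.
elim: w f g h => [|x w IH] f g h; first by rewrite !shuffle_conv_nil mulrA.
have shiftE f' g' w' : shift x (shuffle_conv f' g') w' =
    1 * shuffle_conv (shift x f') g' w' + shuffle_conv f' (shift x g') w'.
  by rewrite /shift shuffle_conv_cons mul1r.
rewrite !(shuffle_conv_cons _ _ x w).
rewrite (eq_shuffle_conv (g := shift x (shuffle_conv g h)) (fun u _ => erefl)
  (fun u _ => shiftE g h u)) shuffle_conv_linearr.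
rewrite (eq_shuffle_conv (f := shift x (shuffle_conv f g)) (fun u _ => shiftE f g u)
  (fun u _ => erefl)) shuffle_conv_linearl.
by rewrite !IH; ring.
Qed.

Lemma shuffle_convC f g w : shuffle_conv f g w = shuffle_conv g f w.
Proof.
elim: w f g => [|x w IH] f g; first by rewrite !shuffle_conv_nil mulrC.
by rewrite !shuffle_conv_cons IH (IH f) addrC.
Qed.

(** The letters selected for [g] all lie in the first gap of [f], hence are read before every letter
    selected for [f]. Together they form one selected word, cut into a [g] part and then an [f]
    part; the gap between the two parts has weight [m] on both sides. *)
Lemma gap_convA m f g h w :
  gap_conv m f (gap_conv m g h) w = gap_conv m (cut_conv g f) h w.
Proof.
elim: w f g h => [|x w IH] f g h /=; first by rewrite cut_conv_nil; ring.
have e1 u : shift x (gap_conv m g h) u =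
    h [::] * gap_conv m (shift x g) m u + gap_conv m g (shift x h) u by [].
have e2 u : shift x (cut_conv g f) u =
    g [::] * shift x f u + cut_conv (shift x g) f u.
  by rewrite /shift cut_conv_cons.
rewrite (eq_gap_conv m (fun u _ => erefl) (fun u _ => e1 u)) gap_conv_linearr.
rewrite (eq_gap_conv m (fun u _ => e2 u) (fun u _ => erefl)) gap_conv_linearl.
by rewrite !IH; ring.
Qed.

Definition is_nil w : K := (size w == 0)%:R.

Lemma shuffle_conv_is_nil f w :
  shuffle_conv is_nil f w = f w /\ shuffle_conv f is_nil w = f w.
Proof.
have z g h x v : (forall u, g u = 0) -> shuffle_conv g h v = 0 /\ shuffle_conv h g v = 0.
  by move=> g0; split; apply: big1 => p _; rewrite g0 ?mul0r ?mulr0.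
elim: w f => [|x w IH] f; first by rewrite !shuffle_conv_nil /is_nil /= mul1r mulr1.
rewrite !shuffle_conv_cons.
have [-> _] := z (shift x is_nil) f x w (fun u => erefl).
have [_ ->] := z (shift x is_nil) f x w (fun u => erefl).
by have [-> ->] := IH (shift x f); rewrite add0r addr0.
Qed.

Lemma cut_conv_is_nil f w : cut_conv is_nil f w = f w /\ cut_conv f is_nil w = f w.
Proof.
elim: w f => [|x w IH] f; first by rewrite !cut_conv_nil /is_nil /= mul1r mulr1.
rewrite !cut_conv_cons; split.
  by rewrite /is_nil mul1r [X in _ + X]big1 ?addr0 // => p _; rewrite /shift mul0r.
by have [_ ->] := IH (shift x f); rewrite /is_nil mulr0 add0r.
Qed.

(* [L f w] is [f w] plus a term depending on [f] at shorter words only. *)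
Definition unitriangular (L : (seq T -> K) -> seq T -> K) :=
  forall f f' w, (forall u, (size u < size w)%N -> f u = f' u) ->
    L f w = L f' w + (f w - f' w).

Lemma shuffle_conv_unitriangular m :
  m [::] = 1 -> unitriangular (fun f => shuffle_conv f m).
Proof.
move=> m1 f f' w; elim: w f f' => [|x w IH] f f' ef.
  by rewrite !shuffle_conv_nil m1; ring.
rewrite !shuffle_conv_cons (IH (shift x f) (shift x f')) => [|u hu]; last exact: ef.
by rewrite (eq_shuffle_conv (f := f) (f' := f') ef (fun u _ => erefl)) /shift; ring.
Qed.

Lemma cut_conv_unitriangular m :
  m [::] = 1 -> unitriangular (fun f => cut_conv f m).
Proof.
move=> m1 f f' w; elim: w f f' => [|x w IH] f f' ef.
  by rewrite !cut_conv_nil m1; ring.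
rewrite !cut_conv_cons (IH (shift x f) (shift x f')) => [|u hu]; last exact: ef.
by rewrite ef // /shift; ring.
Qed.

Lemma gap_conv_unitriangular m :
  m [::] = 1 -> unitriangular (fun f => gap_conv m f m).
Proof.
move=> m1 f f' w; suff gen g : g [::] = 1 -> (forall u, (size u < size w)%N -> f u = f' u) ->
    gap_conv m f g w = gap_conv m f' g w + (f w - f' w) by exact: gen.
elim: w f f' g => [|x w IH] f f' g g1 ef /=; first by rewrite g1; ring.
rewrite g1 (IH (shift x f) (shift x f')) // => [|u hu]; last exact: ef.
by rewrite (eq_gap_conv m (f := f) (f' := f') ef (fun u _ => erefl)) /shift; ring.
Qed.

(** * Tree sums of functionals that are multiplicative under insertion *)

Section TreeSums.
Variable tau : cbpt T -> K.

(** The model is the value of a troupe on a larger tree that contains [t] as a subtree; linear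
    combinations of such values are allowed too. *)
Definition troupe_context (c : bptree T -> K) := forall t1 t2 (v : seq bool) y,
  nonempty t1 -> nonempty t2 -> is_vertex t1 v ->
  c (graft t1 v t2 y) = c t1 * tau (t2, y).

Definition leaf x := BNode BLeaf x BLeaf.

(** Words are reversed, so postorder reads root, right subtree, left subtree: [p.1] goes to the
    right and [p.2] to the left. Equality of sums, rather than of lists, leaves the order of
    enumeration free. *)
Definition root_recursive (sp : seq T -> seq (seq T * seq T)) (trees : seq T -> seq (bptree T)) :=
  trees [::] = [:: BLeaf] /\
  forall (c : bptree T -> K) x w, \sum_(t <- trees (x :: w)) c t =
    \sum_(p <- sp w) \sum_(l <- trees p.2) \sum_(r <- trees p.1) c (BNode l x r).

Definition tree_sum (trees : seq T -> seq (bptree T)) (c : bptree T -> K) w : K :=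
  \sum_(t <- trees w | nonempty t) c t.

Section RootRecursive.
Variables (sp : seq T -> seq (seq T * seq T)) (trees : seq T -> seq (bptree T)).
Hypothesis recP : root_recursive sp trees.
Hypothesis sp_nill : forall f w, \sum_(p <- sp w) is_nil p.1 * f p.2 = f w.
Hypothesis sp_nilr : forall f w, \sum_(p <- sp w) f p.1 * is_nil p.2 = f w.
Implicit Type c : bptree T -> K.

Lemma tree_sum_nil c : tree_sum trees c [::] = 0.
Proof. by rewrite /tree_sum (proj1 recP) big_mkcond big_seq1. Qed.

Lemma sum_trees c w : \sum_(t <- trees w) c t = is_nil w * c BLeaf + tree_sum trees c w.
Proof.
case: w => [|x w].
  by rewrite tree_sum_nil (proj1 recP) big_seq1 /is_nil mul1r addr0.
rewrite /is_nil mul0r add0r /tree_sum [RHS]big_mkcond !(proj2 recP).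
by apply: eq_bigr => p _.
Qed.

(** The four terms record which of the two subtrees of the root are empty. *)
Lemma tree_sum_cons c x w :
  tree_sum trees c (x :: w) = is_nil w * c (leaf x)
    + tree_sum trees (fun t => c (BNode t x BLeaf)) w
    + tree_sum trees (fun t => c (BNode BLeaf x t)) w
    + \sum_(p <- sp w) tree_sum trees
         (fun l => tree_sum trees (fun r => c (BNode l x r)) p.1) p.2.
Proof.
have -> : tree_sum trees c (x :: w) = \sum_(t <- trees (x :: w)) c t.
  by rewrite sum_trees /is_nil mul0r add0r.
rewrite (proj2 recP).
(* The terms with an empty subtree are spread over [sp w] with a weight [is_nil], so that the two
   sides can be compared pair by pair. *)
rewrite -(sp_nill (fun v => is_nil v * c (leaf x)) w).
rewrite -(sp_nill (tree_sum trees (fun t => c (BNode t x BLeaf))) w).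
rewrite -(sp_nilr (tree_sum trees (fun t => c (BNode BLeaf x t))) w).
rewrite -!big_split; apply: eq_bigr => p _ /=.
rewrite (eq_bigr (fun l => is_nil p.1 * c (BNode l x BLeaf)
    + tree_sum trees (fun r => c (BNode l x r)) p.1)); last by move=> l _; rewrite sum_trees.
rewrite big_split /= -mulr_sumr !sum_trees /leaf; ring.
Qed.

(** When [l] and [r] are nonempty, [BNode l x r] is [graft l [::] r x], so the context property
    factors the two-child term. *)
Lemma tree_sum_context_cons c x w : troupe_context c ->
  tree_sum trees c (x :: w) = is_nil w * c (leaf x)
    + tree_sum trees (fun t => c (BNode t x BLeaf)) w
    + tree_sum trees (fun t => c (BNode BLeaf x t)) w
    + \sum_(p <- sp w) tree_sum trees (fun r => tau (r, x)) p.1 * tree_sum trees c p.2.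
Proof.
move=> cc; rewrite tree_sum_cons; congr (_ + _); apply: eq_bigr => p _.
rewrite {1}/tree_sum mulrC [X in X * _]/tree_sum mulr_suml; apply: eq_bigr => l nl.
rewrite /tree_sum mulr_sumr; apply: eq_bigr => r nr.
by rewrite -(cc l r [::] x) //; case: l nl.
Qed.

End RootRecursive.

Lemma tree_sum_linear trees a c c' w :
  tree_sum trees (fun t => a * c t + c' t) w = a * tree_sum trees c w + tree_sum trees c' w.
Proof. by rewrite /tree_sum mulr_sumr -big_split. Qed.

(* The value of [a * m w + L_m (E_c) w], for all three kinds at once: the letter [x]
   becomes a leaf, or the root over an only child, or is expanded from [m (x :: w')]. *)
Fixpoint context_sum a (c : bptree T -> K) w : K :=
  if w is x :: w' then
    context_sum (c (leaf x))
      (fun t => (- a) * tau (t, x) + (c (BNode t x BLeaf) + c (BNode BLeaf x t))) w'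
  else a.

Section Moments.
Variables (L : (seq T -> K) -> seq T -> K) (trees : seq T -> seq (bptree T)) (m : seq T -> K).
Hypothesis tau_troupe : weighted_troupe tau.
Hypothesis m1 : m [::] = 1.
Hypothesis L_linear : forall a f f' w, L (fun u => a * f u + f' u) w = a * L f w + L f' w.
Hypothesis L_ext : forall f f' w, (forall u, (size u <= size w)%N -> f u = f' u) -> L f w = L f' w.
Hypothesis L_nil : forall f, L f [::] = f [::].
Hypothesis trees_nil : forall c, tree_sum trees c [::] = 0.
Let E := tree_sum trees.
Let Et x := E (fun t => tau (t, x)).
Hypothesis L_tree_sum : forall c x w, troupe_context c ->
  (forall v, (size v <= size w)%N -> m (x :: v) = - L (Et x) v) ->
  L (E c) (x :: w) = c (leaf x) * m w + L (E (fun t => c (BNode t x BLeaf))) w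
    + L (E (fun t => c (BNode BLeaf x t))) w.

(** A vertex [v] of [t] is the vertex [false :: v] or [true :: v] once [t] hangs below a new root,
    and insertion there is insertion into [t]. *)
Lemma troupe_contextS a c x : troupe_context c ->
  troupe_context (fun t => a * tau (t, x) + (c (BNode t x BLeaf) + c (BNode BLeaf x t))).
Proof.
move=> cc t1 t2 v y n1 n2 vv; have [_ tt] := tau_troupe.
have := tt (t1, x) (t2, y) v n1 n2 vv; rewrite /nabla /= => ->.
have := cc (BNode t1 x BLeaf) t2 (false :: v) y erefl n2 vv => /= ->.
have := cc (BNode BLeaf x t1) t2 (true :: v) y erefl n2 vv => /= ->.
by ring.
Qed.

Lemma L_tree_sumD a c c' w :
  L (E (fun t => a * c t + c' t)) w = a * L (E c) w + L (E c') w.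
Proof. by rewrite -L_linear; apply: L_ext => u _; rewrite /E tree_sum_linear. Qed.

Lemma context_sumE a c w : troupe_context c ->
  (forall x v, (size v < size w)%N -> m (x :: v) = - L (Et x) v) ->
  a * m w + L (E c) w = context_sum a c w.
Proof.
elim: w a c => [|x w IH] a c cc H /=.
  by rewrite L_nil /E trees_nil m1; ring.
rewrite -IH; [|exact: troupe_contextS|by move=> y v hv; apply/H/leqW].
rewrite L_tree_sum //; last by move=> v hv; apply: H.
rewrite H // L_tree_sumD.
have := L_tree_sumD 1 (fun t => c (BNode t x BLeaf)) (fun t => c (BNode BLeaf x t)) w.
rewrite (L_ext (f' := E (fun t => c (BNode t x BLeaf) + c (BNode BLeaf x t)))) => [->|u _].
  by rewrite /Et; ring.
by apply: eq_bigr => t _; rewrite mul1r.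
Qed.

Lemma moments_context_sum :
  (forall x w, m (x :: w) = - L (Et x) w) <->
  (forall w, m w = context_sum 1 (fun=> 0) w).
Proof.
have c0 : troupe_context (fun=> 0) by move=> *; rewrite mul0r.
(* Linearity at [a = -1] with both functionals zero expresses this value as its own negative plus
   itself. *)
have L0 w : L (E (fun=> 0)) w = 0.
  have := L_tree_sumD (-1) (fun=> 0) (fun=> 0) w.
  rewrite (L_ext (f' := E (fun=> 0))) => [->|u _]; first by ring.
  by apply: eq_bigr => t _; ring.
split=> [H w|M x w].
  by rewrite -context_sumE // mul1r L0 addr0.
(* By definition [context_sum] at [x :: w] starts from the constant 0 and the functional
   [- tau (t, x)] on [w]. Evaluating it by [context_sumE] uses the expansion of [m (y :: v)] only
   for [v] shorter than [w], which is the induction hypothesis. *)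
have [n hn] := ubnP (size w); elim: n x w hn => // n IH x w hn.
rewrite M /= -context_sumE; last by move=> y v hv; apply: IH; exact: leq_trans hv hn.
  rewrite mul0r add0r (L_ext (f' := fun u => -1 * Et x u + 0)) => [|u _].
    rewrite L_linear (L_ext (f := fun=> 0) (f' := E (fun=> 0))) => [|u _]; first by rewrite L0; ring.
    by rewrite /E /tree_sum big1.
  by rewrite [RHS]addr0 /Et /E /tree_sum mulr_sumr; apply: eq_bigr => t _; ring.
exact: (troupe_contextS (-1) x c0).
Qed.

End Moments.

(* Splitting off the letter [x] in a convolution, [E c] becomes the tree sum of
   [tree_sum_context_cons]; its last term, from roots with two children, cancels
   against the expansion of [m (x :: v)], by associativity. *)
Section Kinds.
Variables (trees : seq T -> seq (bptree T)) (m : seq T -> K).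
Let E := tree_sum trees.
Let Et x := E (fun t => tau (t, x)).

Lemma shuffle_conv_tree_sum c x w :
  root_recursive splits trees -> troupe_context c ->
  (forall v, (size v <= size w)%N -> m (x :: v) = - shuffle_conv (Et x) m v) ->
  shuffle_conv (E c) m (x :: w) = c (leaf x) * m w
    + shuffle_conv (E (fun t => c (BNode t x BLeaf))) m w
    + shuffle_conv (E (fun t => c (BNode BLeaf x t))) m w.
Proof.
move=> recP cc H; rewrite shuffle_conv_cons.
rewrite (eq_shuffle_conv (f := shift x (E c)) (g' := m)
  (f' := fun u => c (leaf x) * is_nil u + (1 * E (fun t => c (BNode t x BLeaf)) u
    + (1 * E (fun t => c (BNode BLeaf x t)) u + shuffle_conv (E c) (Et x) u)))) //; last first.
  move=> u _; rewrite /shift /E (tree_sum_context_cons recP) //.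
  - by rewrite shuffle_convC /shuffle_conv /Et /E; ring.
  - by move=> f v; exact: (proj1 (shuffle_conv_is_nil f v)).
  - by move=> f v; exact: (proj2 (shuffle_conv_is_nil f v)).
rewrite !shuffle_conv_linearl (proj1 (shuffle_conv_is_nil _ _)).
rewrite (eq_shuffle_conv (f' := E c) (g := shift x m)
  (g' := fun u => -1 * shuffle_conv (Et x) m u + 0)) //; last first.
  by move=> u hu; rewrite /shift H //; ring.
rewrite shuffle_conv_linearr shuffle_convA.
have -> : shuffle_conv (E c) (fun=> 0) w = 0 by apply: big1 => p _; exact: mulr0.
by ring.
Qed.

(** Right subtrees are read before left ones, so the two-child term is [cut_conv (Et x) (E c)]:
    exactly the order in which [gap_convA] merges the two selections. *)
Lemma gap_conv_tree_sum c x w :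
  m [::] = 1 -> root_recursive cuts trees -> troupe_context c ->
  (forall v, (size v <= size w)%N -> m (x :: v) = - gap_conv m (Et x) m v) ->
  gap_conv m (E c) m (x :: w) = c (leaf x) * m w
    + gap_conv m (E (fun t => c (BNode t x BLeaf))) m w
    + gap_conv m (E (fun t => c (BNode BLeaf x t))) m w.
Proof.
move=> m1 recP cc H /=; rewrite m1 mul1r.
rewrite (eq_gap_conv m (f := shift x (E c)) (g' := m)
  (f' := fun u => c (leaf x) * is_nil u + (1 * E (fun t => c (BNode t x BLeaf)) u
    + (1 * E (fun t => c (BNode BLeaf x t)) u + cut_conv (Et x) (E c) u)))) //; last first.
  move=> u _; rewrite /shift /E (tree_sum_context_cons recP) //.
  - by rewrite /cut_conv /Et /E; ring.
  - by move=> f v; exact: (proj1 (cut_conv_is_nil f v)).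
  - by move=> f v; exact: (proj2 (cut_conv_is_nil f v)).
rewrite !gap_conv_linearl.
rewrite (eq_gap_conv m (f' := E c) (g := shift x m)
  (g' := fun u => -1 * gap_conv m (Et x) m u + 0)) //; last first.
  by move=> u hu; rewrite /shift H //; ring.
have gap0 f v : gap_conv m f (fun=> 0) v = 0.
  by elim: v => [|y v IH] /=; [rewrite mulr0 | rewrite mul0r add0r; exact: IH].
have gap_is_nil g v : gap_conv m is_nil g v = g v.
  elim: v g => [|y v IH] g /=; first by rewrite /is_nil mul1r.
  have z f g' u : (forall u, f u = 0) -> gap_conv m f g' u = 0.
    elim: u f g' => [|z u IHu] f g' f0 /=; first by rewrite f0 mul0r.
    by rewrite (IHu (shift z f)) ?IHu ?mulr0 ?addr0 // => u'; exact: f0.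
  by rewrite z // mulr0 add0r IH.
by rewrite gap_conv_linearr gap_convA gap0 gap_is_nil; ring.
Qed.

(** Here nothing has to cancel: two-child roots are not chains, and [m (x :: w)] occurs only with
    the empty prefix, on which the sum over nonempty trees is 0. *)
Lemma cut_conv_chain_sum c x w : root_recursive cuts trees ->
  let B := tree_sum (fun u => [seq t <- trees u | chain t]) in
  cut_conv (B c) m (x :: w) = c (leaf x) * m w
    + cut_conv (B (fun t => c (BNode t x BLeaf))) m w
    + cut_conv (B (fun t => c (BNode BLeaf x t))) m w.
Proof.
move=> recP B.
(* Being a chain becomes a 0-1 weight, so that the root expansion over all trees applies. *)
have BE d u : B d u = E (fun t => (chain t)%:R * d t) u.
  rewrite /B /E /tree_sum big_filter_cond big_mkcondr /= [LHS]big_mkcond [RHS]big_mkcond.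
  by apply: eq_bigr => t _; case: (chain t); case: (nonempty t); rewrite ?mul1r ?mul0r.
rewrite cut_conv_cons BE /E (tree_sum_nil recP) mul0r add0r.
rewrite (eq_cut_conv (f := shift x (B c)) (g' := m)
  (f' := fun u => c (leaf x) * is_nil u + (1 * B (fun t => c (BNode t x BLeaf)) u
    + B (fun t => c (BNode BLeaf x t)) u))) //; last first.
  move=> u _; rewrite /shift !BE /E (tree_sum_cons recP).
  - rewrite [X in _ + X]big1 ?addr0 => [|p _]; last first.
      rewrite /tree_sum big1 // => l nl; rewrite big1 // => r nr.
      by rewrite /= nl nr mul0r.
    rewrite /= mul1r mul1r mulrC addrA; congr (_ + _ + _); apply: eq_bigr => t _ /=;
      by rewrite ?orbT ?andbT.
  - by move=> f v; exact: (proj1 (cut_conv_is_nil f v)).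
  - by move=> f v; exact: (proj2 (cut_conv_is_nil f v)).
by rewrite !cut_conv_linearl (proj1 (cut_conv_is_nil _ _)); ring.
Qed.

End Kinds.
End TreeSums.
End Convolutions.

(** * Enumeration of trees *)

Section Enumeration.
Variable K : comNzRingType.

Lemma sum_all (U : Type) (P : pred U) (s : seq U) (F : U -> K) :
  all P s -> \sum_(x <- s) F x = \sum_(x <- s | P x) F x.
Proof. by move=> /all_filterP {1}<-; rewrite big_filter. Qed.

Lemma bpts_fuelE T n (s : seq T) : (size s <= n)%N -> bpts_fuel n s = bpts s.
Proof.
suff gen n' : (size s <= n)%N -> (size s <= n')%N -> bpts_fuel n s = bpts_fuel n' s.
  by move=> hn; apply: gen.
elim: n n' s => [|n IH] [|n'] [|x s] // hn hn'; rewrite !ltnS in hn hn'.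
congr flatten; apply: eq_map => k.
have ht : (size (take k (belast x s)) <= size s)%N by rewrite -(size_belast x s) size_take_min geq_minr.
have hd : (size (drop k (belast x s)) <= size s)%N by rewrite -(size_belast x s) size_drop leq_subr.
by rewrite -/bpts_fuel !(IH n') // ?(leq_trans ht) ?(leq_trans hd).
Qed.

Lemma bpts_rcons T (s : seq T) x :
  bpts (rcons s x) = flatten [seq [seq BNode l x r | l <- bpts (take k s), r <- bpts (drop k s)]
                             | k <- iota 0 (size s).+1].
Proof.
have e : bpts (rcons s x) = flatten [seq [seq BNode l x r |
     l <- bpts_fuel (size s) (take k s), r <- bpts_fuel (size s) (drop k s)]
   | k <- iota 0 (size s).+1].
  rewrite /bpts size_rcons; case: s => [|y s] //=.
  by rewrite last_rcons belast_rcons.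
rewrite e; congr flatten; apply: eq_map => k.
by rewrite !bpts_fuelE // ?size_drop ?leq_subr // size_take_min geq_minr.
Qed.

Lemma sum_bpts_rcons T (s : seq T) x (c : bptree T -> K) :
  \sum_(t <- bpts (rcons s x)) c t = \sum_(0 <= k < (size s).+1)
    \sum_(l <- bpts (take k s)) \sum_(r <- bpts (drop k s)) c (BNode l x r).
Proof.
rewrite bpts_rcons big_flatten big_map /index_iota subn0.
by apply: eq_bigr => k _; rewrite big_allpairs_dep.
Qed.

Lemma cutsE T (w : seq T) : cuts w = [seq (take k w, drop k w) | k <- iota 0 (size w).+1].
Proof.
elim: w => // x w IH; rewrite [LHS]/= IH.
have -> : iota 0 (size (x :: w)).+1 = 0 :: [seq k.+1 | k <- iota 0 (size w).+1].
  by rewrite -(iotaDl 1 0).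
by move: (iota 0 _) => it; rewrite map_cons -!map_comp.
Qed.

Lemma bpts_root_recursive T : root_recursive K (@cuts T) (fun w => bpts (rev w)).
Proof.
split=> // c x w; rewrite rev_cons sum_bpts_rcons size_rev.
have iotaE n : iota 0 n = index_iota 0 n by rewrite /index_iota subn0.
(* Cutting [w] after [k] letters cuts [rev w] before its last [k] letters, so the range of cut
   positions is reversed. *)
rewrite cutsE big_map iotaE big_nat_rev big_nat [RHS]big_nat /=.
apply: eq_bigr => k; rewrite ltnS add0n subSS => hk.
by rewrite take_rev drop_rev subKn.
Qed.

(* The color word of a decreasing tree, in increasing order of labels, has the root last,
   and its other letters are shared out arbitrarily between the two subtrees; [w] is this
   word reversed and [n] is fuel. *)
Fixpoint split_trees T n (w : seq T) : seq (bptree T) :=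
  match w, n with
  | [::], _ => [:: BLeaf]
  | x :: u, n'.+1 => flatten [seq [seq BNode l x r | l <- split_trees n' p.2,
                                                    r <- split_trees n' p.1] | p <- splits u]
  | _, _ => [::]
  end.

Lemma size_splits T (w : seq T) :
  all (fun p => (size p.1 <= size w)%N && (size p.2 <= size w)%N) (splits w).
Proof.
elim: w => //= x w IH; rewrite all_cat !all_map /=.
by apply/andP; split; apply: sub_all IH => p /= /andP[h1 h2]; rewrite ?ltnS ?h1 ?h2 (leqW h1, leqW h2).
Qed.

Lemma sum_split_trees_cons T n x (u : seq T) (c : bptree T -> K) :
  \sum_(t <- split_trees n.+1 (x :: u)) c t =
  \sum_(p <- splits u) \sum_(l <- split_trees n p.2) \sum_(r <- split_trees n p.1) c (BNode l x r).
Proof.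
by rewrite /= big_flatten big_map; apply: eq_bigr => p _; rewrite big_allpairs_dep.
Qed.

Lemma sum_split_trees_fuel T n n' (w : seq T) (c : bptree T -> K) :
  (size w <= n)%N -> (size w <= n')%N ->
  \sum_(t <- split_trees n w) c t = \sum_(t <- split_trees n' w) c t.
Proof.
elim: n n' w c => [|n IH] [|n'] [|x w] // c hn hn'.
rewrite !sum_split_trees_cons.
rewrite !(sum_all _ (size_splits w)); apply: eq_bigr => p /andP[h1 h2].
rewrite (IH n') ?(leq_trans h2) //; apply: eq_bigr => l _.
by rewrite (IH n') ?(leq_trans h1).
Qed.

Lemma split_trees_root_recursive T :
  root_recursive K (@splits T) (fun w => split_trees (size w) w).
Proof.
split=> // c x w; rewrite sum_split_trees_cons !(sum_all _ (size_splits w)).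
apply: eq_bigr => p /andP[h1 h2].
rewrite (sum_split_trees_fuel (n' := size p.2)) //; apply: eq_bigr => l _.
exact: sum_split_trees_fuel.
Qed.

(** Comparing each vertex with its children amounts, by transitivity, to comparing it with all its
    descendants. The global form depends only on the postorder word. *)
Lemma decreasing_node l a r : decreasing (BNode l a r) =
  [&& all (fun b => b < a)%N (postorder l ++ postorder r), decreasing l & decreasing r].
Proof.
have H t b : child_lt b t && decreasing t = all (fun d => d < b)%N (postorder t) && decreasing t.
  elim: t b => //= t1 IH1 d t2 IH2 b.
  rewrite !all_cat /= andbT; apply/idP/idP => [/and5P[db c1 c2 d1 d2]|/andP[/and3P[_ _ ->] ->]] //.
  have /andP[a1 _] : all (fun e => e < d)%N (postorder t1) && decreasing t1 by rewrite -IH1 c1.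
  have /andP[a2 _] : all (fun e => e < d)%N (postorder t2) && decreasing t2 by rewrite -IH2 c2.
  rewrite db c1 c2 d1 d2 !andbT; apply/andP.
  by split; [apply: sub_all a1|apply: sub_all a2] => e he; exact: ltn_trans he db.
rewrite /= all_cat.
have := H l a; have := H r a.
by case: (decreasing l); case: (decreasing r); rewrite ?andbT ?andbF // => -> ->.
Qed.

Lemma all_flatten U (a : pred U) (ss : seq (seq U)) : all a (flatten ss) = all (all a) ss.
Proof. by elim: ss => //= s ss IH; rewrite all_cat IH. Qed.

Lemma postorder_bpts (s : seq nat) : all (fun t => postorder t == s) (bpts s).
Proof.
have [n hn] := ubnP (size s); elim: n s hn => // n IH s.
case/lastP: s => [//|s x]; rewrite size_rcons ltnS bpts_rcons => hs.
rewrite all_flatten all_map; apply/allP => k _ /=.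
rewrite all_flatten all_map.
have /IH : (size (take k s) < n)%N by apply: leq_ltn_trans hs; rewrite size_take_min geq_minr.
apply: sub_all => l /eqP el /=; rewrite all_map.
have /IH : (size (drop k s) < n)%N by apply: leq_ltn_trans hs; rewrite size_drop leq_subr.
by apply: sub_all => r /eqP er /=; rewrite el er catA cat_take_drop cats1.
Qed.

Definition decreasing_sum (g : bptree nat -> K) (ls : seq nat) : K :=
  \sum_(w <- permutations ls) \sum_(t <- bpts w | decreasing t) g t.

Lemma sum_decreasing_rcons (g : bptree nat -> K) w x :
  \sum_(t <- bpts (rcons w x) | decreasing t) g t =
  (all (fun b => b < x)%N w)%:R * \sum_(0 <= k < (size w).+1)
    \sum_(l <- bpts (take k w) | decreasing l)
      \sum_(r <- bpts (drop k w) | decreasing r) g (BNode l x r).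
Proof.
rewrite big_mkcond sum_bpts_rcons mulr_sumr; apply: eq_bigr => k _.
rewrite (sum_all _ (postorder_bpts _)) mulr_sumr [RHS]big_mkcond.
rewrite [RHS](sum_all _ (postorder_bpts _)); apply: eq_bigr => l /eqP el.
rewrite (sum_all _ (postorder_bpts _)) [in RHS]mulr_sumr.
case dl : (decreasing l); last first.
  by rewrite big1 // => r _; rewrite decreasing_node dl /= andbF.
rewrite [RHS]big_mkcond [RHS](sum_all _ (postorder_bpts _)); apply: eq_bigr => r /eqP er.
rewrite decreasing_node dl el er cat_take_drop /=.
by case: (all _ _); case: (decreasing r); rewrite ?mul1r ?mul0r.
Qed.

Lemma splits_subseq (u : seq nat) p : p \in splits u -> subseq p.1 u && subseq p.2 u.
Proof.
elim: u p => [|x u IH] p; first by rewrite inE => /eqP ->.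
rewrite mem_cat => /orP[] /mapP[q /IH /andP[h1 h2] ->]; apply/andP; split.
- by rewrite /= eqxx.
- exact: subseq_trans h2 (subseq_cons _ _).
- exact: subseq_trans h1 (subseq_cons _ _).
- by rewrite /= eqxx.
Qed.

Lemma splits_perm (u : seq nat) p : p \in splits u -> perm_eq (p.1 ++ p.2) u.
Proof.
elim: u p => [|x u IH] p; first by rewrite inE => /eqP ->.
rewrite mem_cat => /orP[] /mapP[q /IH hq ->] /=; first by rewrite perm_cons.
by rewrite -cat1s perm_catCA /= perm_cons.
Qed.

Lemma uniq_splits (u : seq nat) : uniq u -> uniq (splits u).
Proof.
elim: u => //= x u IH /andP[xu /IH uu].
rewrite cat_uniq !map_inj_uniq ?uu ?andbT /=.
- apply/hasPn => p /mapP[q /splits_subseq/andP[h1 h2] ->] /=.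
  apply/negP => /mapP[r _ [e _]]; move/negP: xu; apply; apply: (mem_subseq h1).
  by rewrite e mem_head.
- by move=> [a b] [a' b'] /= [-> ->].
- by move=> [a b] [a' b'] /= [-> ->].
Qed.

Lemma filter_splits (P : pred nat) u : (filter P u, filter (predC P) u) \in splits u.
Proof.
elim: u => //= x u IH; rewrite mem_cat; apply/orP.
by case: (P x) => /=; [left|right]; apply/mapP; exists (filter P u, filter (predC P) u).
Qed.

(** A permutation of [u] with a cut is the same as a distribution of the letters of [u] into two
    parts and an ordering of each part. Both sums run exactly once over the pairs [(a, b)] such that
    [a ++ b] is a permutation of [u]. *)
Lemma sum_permutations_cut (u : seq nat) (G : seq nat -> seq nat -> K) : uniq u ->
  \sum_(w <- permutations u) \sum_(0 <= k < (size w).+1) G (take k w) (drop k w) =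
  \sum_(p <- splits u) \sum_(a <- permutations p.2) \sum_(b <- permutations p.1) G a b.
Proof.
move=> uu.
pose A := [seq (take k w, drop k w) | w <- permutations u, k <- iota 0 (size u).+1].
pose B := [seq ab | p <- splits u, ab <- [seq (a, b) | a <- permutations p.2, b <- permutations p.1]].
(* Since the letters of [u] are distinct, [a] and [b] determine which letters went to which part. *)
have splitE p a b : p \in splits u -> a \in permutations p.2 -> b \in permutations p.1 ->
    p = (filter (mem b) u, filter (mem a) u).
  rewrite !mem_permutations => /splits_subseq/andP[/(subseq_uniqP uu) e1 /(subseq_uniqP uu) e2].
  move=> /perm_mem ea /perm_mem eb; case: p => p1 p2 /= in e1 e2 ea eb *.
  congr (_, _); [rewrite {1}e1|rewrite {1}e2]; apply: eq_filter => x /=; exact/esym.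
have mA a b : ((a, b) \in A) = perm_eq (a ++ b) u.
  apply/allpairsP/idP => [[[w k] /= [hw _ [-> ->]]]|hp].
    by rewrite cat_take_drop -mem_permutations.
  exists (a ++ b, size a); split; rewrite ?mem_permutations //=.
    by rewrite -[_ :: _]/(iota 0 (size u).+1) mem_iota add0n ltnS -(perm_size hp) size_cat leq0n leq_addr.
  by rewrite take_size_cat // drop_size_cat.
have mB a b : ((a, b) \in B) = perm_eq (a ++ b) u.
  apply/allpairsPdep/idP => [[p [ab [hp /allpairsP[[a' b'] /= [ha hb ->]] [-> ->]]]]|hp].
    rewrite !mem_permutations in ha hb.
    by rewrite perm_catC (permPl (perm_cat hb ha)) splits_perm.
  have uab : uniq (a ++ b) by rewrite (perm_uniq hp).
  have [ua dab ub] : [/\ uniq a, ~~ has (mem a) b & uniq b] by apply/and3P; rewrite -cat_uniq.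
  exists (filter (mem b) u, filter (mem a) u), (a, b); split=> //.
    rewrite (_ : filter (mem a) u = filter (predC (mem b)) u) ?filter_splits //.
    apply: eq_in_filter => x; rewrite -(perm_mem hp) mem_cat /=.
    case xa: (x \in a) => /=; last by move=> ->.
    by move=> _; apply/esym/negP => /(hasPn dab); rewrite /= xa.
  apply/allpairsP; exists (a, b); split=> //=; rewrite mem_permutations;
    apply: uniq_perm => //; rewrite ?filter_uniq // => x;
    rewrite mem_filter -(perm_mem hp) mem_cat /=; by case: (x \in a); case: (x \in b).
have AB : perm_eq A B.
  apply: uniq_perm; last by move=> [a b]; rewrite mA mB.
    apply: allpairs_uniq; rewrite ?permutations_uniq ?iota_uniq //.
    have takeE w k : w \in permutations u -> k \in iota 0 (size u).+1 -> size (take k w) = k.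
      by rewrite mem_permutations mem_iota leq0n add0n ltnS => /perm_size <- /size_takel.
    move=> q q' /allpairsP[[w k] [hw hk ->]] /allpairsP[[w' k'] [hw' hk' ->]] [et ed].
    have ew : w = w' by rewrite -(cat_take_drop k w) et ed cat_take_drop.
    by rewrite -(takeE _ _ hw hk) et (takeE _ _ hw' hk') ew.
  apply: allpairs_uniq_dep.
  - exact: uniq_splits.
  - move=> p _; apply: allpairs_uniq; rewrite ?permutations_uniq //.
    by move=> [a b] [a' b'].
  move=> q q' /allpairsPdep[p [ab [hp /allpairsP[[a b] /= [ha hb ->]] ->]]].
  move=> /allpairsPdep[p' [ab' [hp' /allpairsP[[a' b'] /= [ha' hb' ->]] ->]]] /= [ea eb].
  by rewrite -ea -eb in ha' hb' *; rewrite (splitE p a b) // (splitE p' a b).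
transitivity (\sum_(ab <- A) G ab.1 ab.2).
  rewrite big_allpairs_dep; apply: eq_big_seq => w; rewrite mem_permutations => hw.
  by rewrite /index_iota subn0 (perm_size hw).
rewrite (perm_big _ AB) big_allpairs_dep; apply: eq_bigr => p _.
by rewrite big_allpairs_dep.
Qed.

(** The largest label [x] must be at the root, so it ends the postorder word. The rest of the word
    is an arbitrary permutation of [u], cut between the left and the right subtree. *)
Lemma decreasing_sum_cons g x u : all (fun b => b < x)%N u -> uniq u ->
  decreasing_sum g (x :: u) = \sum_(p <- splits u)
    decreasing_sum (fun l => decreasing_sum (fun r => g (BNode l x r)) p.1) p.2.
Proof.
move=> ux uu; have xu : x \notin u by apply/negP => /(allP ux); rewrite ltnn.
rewrite /decreasing_sum (bigID (fun w => last 0%N w == x)) /=.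
rewrite [X in _ + X]big_seq_cond [X in _ + X]big1 ?addr0; last first.
  move=> w; rewrite mem_permutations; case/lastP: w => [|w y].
    by rewrite perm_sym => /andP[/perm_nilP].
  rewrite last_rcons => /andP[hp yx]; rewrite sum_decreasing_rcons.
  case: allP => [hw|]; last by rewrite mul0r.
  have := perm_mem hp x; rewrite mem_rcons !inE eqxx eq_sym (negPf yx) /= => /hw xy.
  have := perm_mem hp y; rewrite mem_rcons !inE eqxx (negPf yx) /= => /esym/(allP ux).
  by move=> /(ltn_trans xy); rewrite ltnn.
rewrite -big_filter (perm_big [seq rcons w x | w <- permutations u]) /=; last first.
  apply: uniq_perm.
  - by rewrite filter_uniq // permutations_uniq.
  - by rewrite map_inj_uniq ?permutations_uniq //; exact: rcons_injl.
  move=> w; rewrite mem_filter mem_permutations; apply/andP/mapP.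
    case/lastP: w => [|w y]; first by rewrite perm_sym => -[_ /perm_nilP].
    rewrite last_rcons => -[/eqP -> hp]; exists w => //.
    by rewrite mem_permutations -(perm_cons x) -perm_rcons perm_sym perm_sym.
  move=> [v]; rewrite mem_permutations => hv ->; rewrite last_rcons; split=> //.
  by rewrite perm_rcons perm_cons.
rewrite big_map.
rewrite (eq_big_seq (fun w => \sum_(0 <= k < (size w).+1)
    \sum_(l <- bpts (take k w) | decreasing l)
      \sum_(r <- bpts (drop k w) | decreasing r) g (BNode l x r))); last first.
  move=> w; rewrite mem_permutations => hw.
  by rewrite sum_decreasing_rcons (perm_all _ hw) ux mul1r.
rewrite (sum_permutations_cut (fun a b => \sum_(l <- bpts a | decreasing l)
      \sum_(r <- bpts b | decreasing r) g (BNode l x r)) uu).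
apply: eq_bigr => p _; apply: eq_bigr => a _; rewrite exchange_big /=.
by apply: eq_bigr => l _.
Qed.

Lemma splits_map T (h : nat -> T) u :
  splits (map h u) = [seq (map h p.1, map h p.2) | p <- splits u].
Proof. by elim: u => //= x u ->; rewrite map_cat -!map_comp. Qed.

(** Subtrees carry arbitrary sets of labels, so the induction is over all decreasing label lists.
    The labels stay distinct, as the permutation argument requires, while the colors given by [h]
    may repeat. *)
Lemma decreasing_sum_split_trees T (h : nat -> T) (c : bptree T -> K) ls :
  sorted gtn ls ->
  decreasing_sum (fun t => c (tmap h t)) ls = \sum_(t <- split_trees (size ls) (map h ls)) c t.
Proof.
have [n hn] := ubnP (size ls); elim: n ls c hn => // n IH [|x u] c hn hs.
  by rewrite /decreasing_sum /= !big_seq1 big_mkcond big_seq1.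
have gt_trans : transitive gtn by move=> a b d /= ba db; exact: ltn_trans db ba.
have us := path_sorted hs.
rewrite decreasing_sum_cons; first last.
- by apply: sorted_uniq us => // a; exact: ltnn.
- exact: order_path_min hs.
rewrite [size _]/= [map _ _]/= sum_split_trees_cons splits_map big_map.
apply: eq_big_seq => p /splits_subseq/andP[p1 p2] /=.
rewrite /= ltnS in hn.
have s1 := leq_ltn_trans (size_subseq p1) hn; have s2 := leq_ltn_trans (size_subseq p2) hn.
rewrite -(sum_split_trees_fuel (n := size p.2)) ?size_map ?size_subseq //.
rewrite -(IH p.2 (fun l => \sum_(r <- split_trees (size u) (map h p.1)) c (BNode l (h x) r))) //; last first.
  exact: subseq_sorted us.
apply: eq_bigr => w _; apply: eq_bigr => t _.
rewrite -(sum_split_trees_fuel (n := size p.1)) ?size_map ?size_subseq //.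
rewrite -(IH p.1 (fun r => c (BNode (tmap h t) (h x) r))) //.
exact: subseq_sorted us.
Qed.

Lemma sum_DBPT_split_trees I (tau : cbpt I -> K) (s : seq I) (j : I) :
  sum_DBPT tau s j = \sum_(t <- split_trees (size (rev s)) (rev s)) tau (t, j).
Proof.
transitivity (decreasing_sum (fun t => tau (tmap (nth j s) t, j)) (rev (iota 0 (size s)))).
  by apply: perm_big; apply: perm_permutations; rewrite perm_sym perm_rev.
rewrite (@decreasing_sum_split_trees _ (nth j s) (fun t => tau (t, j))).
  by rewrite map_rev map_nth_iota0 // take_size !size_rev size_iota.
by rewrite rev_sorted; exact: iota_ltn_sorted.
Qed.

End Enumeration.

(** * Sums over set partitions *)

Section PartitionSums.
Variables (K : comNzRingType) (T : finType).
Implicit Types (P Q : {set {set T}}) (S U V D : {set T}) (c : {set T} -> K)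
  (ok : pred {set {set T}}).

Definition partition_sum c ok S : K :=
  \sum_(P | partition P S && ok P) \prod_(U in P) c U.

Lemma partition_sum0 c ok : ok set0 -> partition_sum c ok set0 = 1.
Proof.
move=> ok0; rewrite /partition_sum (big_pred1 set0) ?big_set0 // => P.
by rewrite partition_set0 /=; case: eqP => [->|].
Qed.

Lemma eq_partition_sum c ok ok' S : (forall P, partition P S -> ok P = ok' P) ->
  partition_sum c ok S = partition_sum c ok' S.
Proof.
by move=> e; apply: eq_bigl => P; case hP: (partition P S) => //=; rewrite e.
Qed.

Lemma partition_setU1 (Q : {set {set T}}) (S U : {set T}) : U != set0 -> U \subset S ->
  (partition (U |: Q) S && (U \notin Q)) = partition Q (S :\: U).
Proof.
move=> U0 US; apply/andP/idP => [[hP hU]|hQ].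
  by rewrite -(setU1K hU); apply: partitionD1 => //; exact: setU11.
have dU : [disjoint U & S :\: U] by rewrite -setI_eq0 setIDA setIC -setIDA setDv setI0.
split; last first.
  apply/negP => /(partitionS hQ) => h; move/set0Pn: U0 => [x xU].
  by have := subsetP h x xU; rewrite inE xU.
rewrite (_ : S = U :|: (S :\: U)); first exact: partitionU1.
by apply/setP => x; rewrite !inE; case xU: (x \in U) => //=; exact: (subsetP US).
Qed.

Lemma partition_sum_block c ok (S : {set T}) (x : T) : x \in S ->
  partition_sum c ok S = \sum_(U : {set T} | (U \subset S) && (x \in U))
    c U * partition_sum c (fun Q => ok (U |: Q)) (S :\: U).
Proof.
move=> xS; rewrite /partition_sum.
rewrite (partition_big (fun P => pblock P x) (fun U : {set T} => (U \subset S) && (x \in U))) /=; last first.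
  move=> P /andP[hP _]; have xP : x \in cover P by rewrite (cover_partition hP).
  by rewrite mem_pblock xP (partitionS hP) ?pblock_mem.
apply: eq_bigr => U /andP[US xU].
have U0 : U != set0 by apply/set0Pn; exists x.
rewrite mulr_sumr (reindex_onto (fun Q => U |: Q) (fun P => P :\ U)) /=; last first.
  move=> P /andP[/andP[hP _] /eqP <-]; rewrite setD1K //; apply: pblock_mem.
  by rewrite (cover_partition hP).
have UE Q : ((U |: Q) :\ U == Q) = (U \notin Q).
  apply/eqP/idP => [<-|]; last exact: setU1K.
  by rewrite !inE eqxx.
apply: eq_big => [Q|Q].
  rewrite UE -(partition_setU1 Q U0 US).
  case hP: (partition _ _) => //=; rewrite [RHS]andbC.
  have := def_pblock (partition_trivIset hP) (setU11 U Q) xU => ->.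
  by rewrite eqxx andbT.
by move=> /andP[_]; rewrite UE => hU; rewrite big_setU1.
Qed.

Lemma partition_subsets D1 D2 Q : [disjoint D1 & D2] ->
  (forall V, V \in Q -> (V \subset D1) || (V \subset D2)) ->
  partition Q (D1 :|: D2) -> partition (Q ::&: D1) D1.
Proof.
move=> dD hV /and3P[/eqP cQ tQ Q0]; apply/and3P; split.
- rewrite eqEsubset; apply/andP; split.
    by apply/subsetP => x /bigcupP[V /setIdP[_ /subsetP VD] /VD].
  apply/subsetP => x xD; have : x \in cover Q by rewrite cQ inE xD.
  move=> /bigcupP[V VQ xV]; apply/bigcupP; exists V => //; rewrite inE VQ /=.
  have /orP[//|/subsetP/(_ x xV) xD2] := hV V VQ.
  by move/disjointFr: dD => /(_ x xD); rewrite xD2.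
- exact: trivIsetI.
- by rewrite inE (negPf Q0).
Qed.

(* If no block meets both [D1] and [D2], the partition splits into two independent ones. *)
Lemma partition_sumU c ok ok1 ok2 D1 D2 : [disjoint D1 & D2] ->
  (forall Q1 Q2, partition Q1 D1 -> partition Q2 D2 -> ok (Q1 :|: Q2) = ok1 Q1 && ok2 Q2) ->
  (forall Q V, partition Q (D1 :|: D2) -> ok Q -> V \in Q -> (V \subset D1) || (V \subset D2)) ->
  partition_sum c ok (D1 :|: D2) = partition_sum c ok1 D1 * partition_sum c ok2 D2.
Proof.
move=> dD okU okS; rewrite /partition_sum big_distrlr /= pair_big /=.
pose g Q := (Q ::&: D1, Q ::&: D2).
have d21 : [disjoint D2 & D1] by rewrite disjoint_sym.
have sub0 D D' V : [disjoint D & D'] -> V \subset D -> V \subset D' -> V = set0.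
  move=> dd VD VD'; apply/eqP; rewrite -subset0.
  by move: dd; rewrite -setI_eq0 => /eqP <-; rewrite subsetI VD.
have gK Q1 Q2 : partition Q1 D1 -> partition Q2 D2 -> g (Q1 :|: Q2) = (Q1, Q2).
  move=> h1 h2; congr (_, _); apply/setP => V; rewrite !inE.
    case V1: (V \in Q1); first by rewrite (partitionS h1 V1).
    case V2: (V \in Q2) => //=; apply/negP => VD.
    by move: (partition_neq0 h2 V2); rewrite (sub0 D1 D2 V) ?eqxx // (partitionS h2 V2).
  case V2: (V \in Q2); first by rewrite orbT (partitionS h2 V2).
  case V1: (V \in Q1) => //=; apply/negP => VD.
  by move: (partition_neq0 h1 V1); rewrite (sub0 D1 D2 V) ?eqxx // (partitionS h1 V1).
have dQ Q1 Q2 : partition Q1 D1 -> partition Q2 D2 -> [disjoint Q1 & Q2].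
  move=> h1 h2; rewrite disjoint_subset; apply/subsetP => V V1; rewrite inE; apply/negP => V2.
  by move: (partition_neq0 h1 V1); rewrite (sub0 D1 D2 V) ?eqxx ?(partitionS h1 V1) ?(partitionS h2 V2).
have partU Q1 Q2 : partition Q1 D1 -> partition Q2 D2 -> partition (Q1 :|: Q2) (D1 :|: D2).
  move=> h1 h2; apply/and3P; split.
  - by rewrite /cover bigcup_setU -!/(cover _) (cover_partition h1) (cover_partition h2).
  - apply: trivIsetU; rewrite ?(partition_trivIset h1) ?(partition_trivIset h2) //.
    by rewrite (cover_partition h1) (cover_partition h2).
  - by rewrite inE (partition0 h1) (partition0 h2).
have gP Q : partition Q (D1 :|: D2) -> ok Q -> partition (Q ::&: D1) D1 /\ partition (Q ::&: D2) D2.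
  move=> hQ okQ; have hV V : V \in Q -> (V \subset D1) || (V \subset D2) by exact: okS.
  split; first exact: partition_subsets hV hQ.
  by apply: (@partition_subsets D2 D1); rewrite 1?setUC // => V /hV; rewrite orbC.
rewrite (reindex_onto (fun q => q.1 :|: q.2) g) /=; last first.
  move=> Q /andP[hQ okQ]; apply/setP => V; rewrite !inE.
  by case VQ: (V \in Q) => //=; exact: okS hQ okQ VQ.
apply: eq_big => [[Q1 Q2]|[Q1 Q2]] /=; last first.
  move=> /andP[/andP[hQ okQ] /eqP [e1 e2]].
  have [] := gP _ hQ okQ; rewrite e1 e2 => h1 h2.
  by rewrite -bigU ?dQ //; apply: eq_bigl => V; rewrite inE.
apply/idP/idP => [/andP[/andP[hQ okQ] /eqP [e1 e2]]|/andP[/andP[h1 o1] /andP[h2 o2]]].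
  have [] := gP _ hQ okQ; rewrite e1 e2 => h1 h2.
  by move: okQ; rewrite h1 h2 okU // => /andP[-> ->].
by rewrite partU // okU // o1 o2 (gK Q1 Q2) ?eqxx.
Qed.

End PartitionSums.

Section PartitionImset.
Variables (K : comNzRingType) (T' T : finType) (h : T' -> T).
Hypothesis h_inj : injective h.

Lemma partition_sum_imset (c : {set T} -> K) (ok : pred {set {set T}}) :
  partition_sum (fun U => c (h @: U)) (fun P => ok [set h @: (U : {set T'}) | U in P]) setT
  = partition_sum c ok (h @: setT).
Proof.
rewrite /partition_sum [RHS](reindex_onto (fun P : {set {set T'}} => [set h @: (U : {set T'}) | U in P])
  (fun Q => [set h @^-1: (V : {set T}) | V in Q])) /=; last first.
  move=> Q /andP[hQ _]; rewrite -imset_comp -[RHS]imset_id; apply: eq_in_imset => V VQ /=.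
  apply/setP => x; apply/imsetP/idP => [[y]|xV]; first by rewrite inE => yV ->.
  have /imsetP[y _ e] := subsetP (partitionS hQ VQ) x xV.
  by exists y; rewrite ?inE -?e.
apply: eq_big => [P|P _]; last first.
  by rewrite big_imset //= => U U' _ _; exact: imset_inj.
rewrite imset_partition // -imset_comp.
rewrite (_ : [set _ | _ in _] = P) ?eqxx ?andbT // -[RHS]imset_id.
apply: eq_in_imset => U _ /=; apply/setP => x.
by rewrite inE mem_imset.
Qed.
End PartitionImset.

(** * Noncrossing and interval partitions of sets of positions *)

Section OrdinalPartitions.
Variables (K : comNzRingType) (N : nat).
Implicit Types (P Q : {set {set 'I_N}}) (S U V D : {set 'I_N}) (s u v : seq 'I_N).
Implicit Types (f g m : seq 'I_N -> K).

Definition decr s := sorted (fun i j : 'I_N => (j < i)%N) s.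

(** Positions outside [S] are ignored: this is what being an interval partition becomes after [S] is
    renumbered increasingly. *)
Definition interval_in S P : bool :=
  [forall U in P, forall a : 'I_N, forall b : 'I_N, forall c : 'I_N,
     [&& (a < b)%N, (b < c)%N, a \in U, c \in U & b \in S] ==> (b \in U)].

Definition unseparated U V : bool :=
  [forall u in U, forall a in V, forall b in V, ~~ ((a < u)%N && (u < b)%N)].

Definition upper U S : bool :=
  [forall a in U, forall b in S, (a < b)%N ==> (b \in U)].

(** This is the condition left on the other blocks when the block [U] of the largest position is
    removed from a noncrossing partition. *)
Definition noncrossing_around U Q : bool :=
  noncrossing Q && [forall V in Q, unseparated U V].

Lemma noncrossingP P :
  reflect (forall U V (a b c d : 'I_N), U \in P -> V \in P -> U != V ->
    (a < b)%N -> (b < c)%N -> (c < d)%N -> a \in U -> c \in U -> b \in V -> d \in V -> False)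
  (noncrossing P).
Proof.
apply: (iffP idP) => [h U V a b c d UP VP UV ab bc cd aU cU bV dV|h].
  move: h => /forall_inP/(_ U UP)/forall_inP/(_ V VP)/implyP/(_ UV).
  move=> /forallP/(_ a)/forallP/(_ b)/forallP/(_ c)/forallP/(_ d).
  by rewrite ab bc cd aU cU bV dV.
apply/forall_inP => U UP; apply/forall_inP => V VP; apply/implyP => UV.
apply/forallP => a; apply/forallP => b; apply/forallP => c; apply/forallP => d.
apply/negP => /and5P[ab bc cd aU /and3P[cU bV dV]].
exact: (h U V a b c d).
Qed.

Lemma unseparatedP U V :
  reflect (forall u a b : 'I_N, u \in U -> a \in V -> b \in V -> (a < u)%N -> (u < b)%N -> False)
  (unseparated U V).
Proof.
apply: (iffP idP) => [h u a b uU aV bV au ub|h].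
  by move: h => /forall_inP/(_ u uU)/forall_inP/(_ a aV)/forall_inP/(_ b bV); rewrite au ub.
apply/forall_inP => u uU; apply/forall_inP => a aV; apply/forall_inP => b bV.
by apply/negP => /andP[]; exact: h.
Qed.

Lemma interval_inP S P :
  reflect (forall U (a b c : 'I_N), U \in P ->
    (a < b)%N -> (b < c)%N -> a \in U -> c \in U -> b \in S -> b \in U)
  (interval_in S P).
Proof.
apply: (iffP idP) => [h U a b c UP ab bc aU cU bS|h].
  move: h => /forall_inP/(_ U UP)/forallP/(_ a)/forallP/(_ b)/forallP/(_ c).
  by rewrite ab bc aU cU bS.
apply/forall_inP => U UP; apply/forallP => a; apply/forallP => b; apply/forallP => c.
by apply/implyP => /and5P[ab bc aU cU bS]; exact: (h U a b c).
Qed.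

Lemma upperP U S :
  reflect (forall a b : 'I_N, a \in U -> b \in S -> (a < b)%N -> b \in U) (upper U S).
Proof.
apply: (iffP idP) => [h a b aU bS ab|h].
  by move: h => /forall_inP/(_ a aU)/forall_inP/(_ b bS); rewrite ab.
apply/forall_inP => a aU; apply/forall_inP => b bS; apply/implyP => ab; exact: h ab.
Qed.

(** If [u] in [U] lies between [a] and [b] of another block, then [a < u < b < y] is a crossing.
    Conversely, a crossing that involves [U] puts a point of [U] between two points of the other
    block. *)
Lemma noncrossing_setU1 U D Q y : y \in U -> [disjoint U & D] ->
  (forall d, d \in D -> d < y)%N -> partition Q D ->
  noncrossing (U |: Q) = noncrossing_around U Q.
Proof.
move=> yU dUD Dy hQ.
have UQ V : V \in Q -> U != V.
  move=> VQ; apply: contraTneq dUD => UV; apply/pred0Pn; exists y => /=.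
  by rewrite yU (subsetP (partitionS hQ VQ)) // -UV.
apply/noncrossingP/andP => [h|[/noncrossingP h /forall_inP h']].
  split; first by apply/noncrossingP => A B a b c d hA hB; apply: h; rewrite inE ?hA ?hB orbT.
  apply/forall_inP => V VQ; apply/unseparatedP => u a b uU aV bV au ub.
  apply: (h V U a u b y); rewrite ?inE ?eqxx ?VQ ?orbT // 1?eq_sym ?UQ //.
  exact/Dy/(subsetP (partitionS hQ VQ)).
move=> A B a b c d; rewrite !inE => /orP[/eqP ->|AQ] /orP[/eqP ->|BQ].
- by rewrite eqxx.
- by move=> _ ab bc cd aA cA bB dB; exact: (unseparatedP _ _ (h' B BQ) c b d).
- by move=> _ ab bc cd aA cA bB dB; exact: (unseparatedP _ _ (h' A AQ) b a c).
- exact: h.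
Qed.

(** An interval of [S] that contains the largest element of [S] is an upper set. Removing it leaves
    no point of it between two remaining ones. *)
Lemma interval_in_setU1 U S Q y : y \in U -> U \subset S ->
  (forall d, d \in S -> d <= y)%N -> partition Q (S :\: U) ->
  interval_in S (U |: Q) = upper U S && interval_in (S :\: U) Q.
Proof.
move=> yU US Sy hQ.
apply/interval_inP/andP => [h|[/upperP h /interval_inP h'] A a b c].
  split.
    apply/upperP => a b aU bS ab; have := Sy b bS; rewrite leq_eqVlt => /orP[/eqP/val_inj -> //|lby].
    by apply: (h U a b y); rewrite ?inE ?eqxx.
  apply/interval_inP => V a b c VQ ab bc aV cV; rewrite inE => /andP[bU bS].
  by apply: (h V a b c); rewrite ?inE ?VQ ?orbT.
rewrite !inE => /orP[/eqP ->|AQ] ab bc aA cA bS; first exact: (h a b).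
apply: (h' A a b c) => //; rewrite inE bS andbT; apply/negP => bU.
have := subsetP (partitionS hQ AQ) c cA; rewrite inE => /andP[/negP cU cS]; apply: cU.
exact: (h b c).
Qed.

Section BlockWeights.
Variable c : {set 'I_N} -> K.

Definition nc_sum := partition_sum c (@noncrossing N).

(** A block that meets both [D1] and [D2] would have [y] between two of its points, so the two sides
    are independent. [U] lies below [y] and constrains only [D1]; [y] itself lies between no two
    points of the same side. *)
Lemma noncrossing_around_sum_split (y : 'I_N) U D1 D2 :
  (forall d, d \in U -> d < y)%N -> (forall d, d \in D1 -> d < y)%N ->
  (forall d, d \in D2 -> y < d)%N ->
  partition_sum c (noncrossing_around (y |: U)) (D1 :|: D2)
  = partition_sum c (noncrossing_around U) D1 * nc_sum D2.
Proof.
move=> Uy D1y D2y; apply: partition_sumU.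
- rewrite -setI_eq0; apply/eqP/setP => x; rewrite !inE.
  by apply/negP => /andP[/D1y h1 /D2y h2]; have := ltn_trans h1 h2; rewrite ltnn.
- move=> Q1 Q2 hQ1 hQ2.
  have b1 V a : V \in Q1 -> a \in V -> (a < y)%N by move=> VQ aV; exact/D1y/(subsetP (partitionS hQ1 VQ)).
  have b2 V a : V \in Q2 -> a \in V -> (y < a)%N by move=> VQ aV; exact/D2y/(subsetP (partitionS hQ2 VQ)).
  apply/andP/andP => [[/noncrossingP h /forall_inP h']|[/andP[/noncrossingP h1 /forall_inP h1'] /noncrossingP h2]].
    split; last by apply/noncrossingP => A B i j k l hA hB; apply: h; rewrite inE ?hA ?hB orbT.
    apply/andP; split; first by apply/noncrossingP => A B i j k l hA hB; apply: h; rewrite inE ?hA ?hB.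
    apply/forall_inP => V VQ; have /h'/unseparatedP hV : V \in Q1 :|: Q2 by rewrite inE VQ.
    by apply/unseparatedP => u a b uU; apply: hV; rewrite !inE uU orbT.
  split.
    apply/noncrossingP => A B i j k l; rewrite !inE => /orP[A1|A2] /orP[B1|B2].
    - exact: h1.
    - move=> _ _ jk _ _ kA jB _.
      by have := ltn_trans (ltn_trans jk (b1 _ _ A1 kA)) (b2 _ _ B2 jB); rewrite ltnn.
    - move=> _ ij _ _ iA _ jB _.
      by have := ltn_trans (ltn_trans ij (b1 _ _ B1 jB)) (b2 _ _ A2 iA); rewrite ltnn.
    - exact: h2.
  apply/forall_inP => V; rewrite inE => /orP[V1|V2]; apply/unseparatedP => u a b;
    rewrite !inE => /orP[/eqP ->|uU] aV bV au ub.
  - by have := ltn_trans ub (b1 _ _ V1 bV); rewrite ltnn.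
  - exact: (unseparatedP _ _ (h1' V V1) u a b).
  - by have := ltn_trans au (b2 _ _ V2 aV); rewrite ltnn.
  - by have := ltn_trans (ltn_trans au (Uy u uU)) (b2 _ _ V2 aV); rewrite ltnn.
move=> Q V hQ /andP[_ /forall_inP h] VQ; apply/orP.
case: (boolP (V \subset D1)) => [|/subsetPn[x xV xD]]; [by left|right].
apply/subsetP => z zV; have /subsetP sV := partitionS hQ VQ.
have := sV z zV; rewrite inE => /orP[zD|//].
have := sV x xV; rewrite inE (negPf xD) /= => xD2.
by case: (unseparatedP _ _ (h V VQ) y z x); rewrite ?setU11 ?D1y ?D2y.
Qed.

End BlockWeights.
End OrdinalPartitions.

(** * Convolutions as sums over subsets of positions *)

Section SubsetSums.
Variables (K : comNzRingType) (T : finType).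
Implicit Types (s : seq T) (A U : {set T}) (F : {set T} -> K) (f g : seq T -> K).

Lemma sum_subset_mem y A F : y \notin A ->
  \sum_(U : {set T} | (U \subset y |: A) && (y \in U)) F U
  = \sum_(U : {set T} | U \subset A) F (y |: U).
Proof.
move=> yA; rewrite (reindex_onto (fun U => y |: U) (fun U => U :\ y)) /=; last first.
  by move=> U /andP[_ yU]; rewrite setD1K.
apply: eq_bigl => U; rewrite setU11 andbT.
have -> : ((y |: U) :\ y == U) = (y \notin U).
  by apply/eqP/idP => [<-|]; [rewrite !inE eqxx|exact: setU1K].
apply/andP/idP => [[UA yU]|UA].
  by rewrite -(setU1K yU) subDset.
by rewrite setUS //; split=> //; apply: contra yA; exact: (subsetP UA).
Qed.

Lemma sum_subset_setU1 y A F : y \notin A ->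
  \sum_(U : {set T} | U \subset y |: A) F U
  = \sum_(U : {set T} | U \subset A) F (y |: U) + \sum_(U : {set T} | U \subset A) F U.
Proof.
move=> yA; rewrite (bigID (fun U : {set T} => y \in U)) /= sum_subset_mem //; congr (_ + _).
apply: eq_bigl => U; apply/andP/idP => [[/subsetP UA yU]|UA].
  apply/subsetP => x xU; have := UA x xU; rewrite !inE => /orP[/eqP xy|//].
  by rewrite -xy xU in yU.
split; first exact: subset_trans UA (subsetUr _ _).
by apply: contra yA; exact: (subsetP UA).
Qed.

Lemma filter_mem_setU1 y s U : y \notin s ->
  [seq i <- y :: s | i \in y |: U] = y :: [seq i <- s | i \in U] /\
  [seq i <- y :: s | i \notin y |: U] = [seq i <- s | i \notin U].
Proof.
move=> ys /=; rewrite setU11 /=.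
have e i : i \in s -> (i \in y |: U) = (i \in U).
  by move=> si; rewrite !inE; case: eqP => // iy; rewrite -iy si in ys.
by split; [congr (_ :: _)|]; apply: eq_in_filter => i /e ->.
Qed.

Lemma notin_subset_seq y s U : y \notin s -> U \subset [set i in s] -> y \notin U.
Proof. by move=> ys /subsetP Us; apply: contra ys => /Us; rewrite inE. Qed.

Lemma filter_mem_cons y s U : y \notin U ->
  [seq i <- y :: s | i \in U] = [seq i <- s | i \in U] /\
  [seq i <- y :: s | i \notin U] = y :: [seq i <- s | i \notin U].
Proof. by move=> /negPf /= ->. Qed.

Lemma subset_seq_nil U : (U \subset [set i in [::]]) = (U == set0).
Proof. by rewrite -subset0; congr (U \subset _); apply/setP => i; rewrite !inE. Qed.

Lemma shuffle_conv_subsets f g s : uniq s ->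
  shuffle_conv f g s = \sum_(U : {set T} | U \subset [set i in s])
    f [seq i <- s | i \in U] * g [seq i <- s | i \notin U].
Proof.
elim: s f g => [|y s IH] f g.
  by rewrite shuffle_conv_nil => _; rewrite (big_pred1 set0) // => U; rewrite subset_seq_nil.
move=> /andP[ys us]; rewrite shuffle_conv_cons set_cons sum_subset_setU1 ?inE //.
rewrite !IH //; congr (_ + _); apply: eq_bigr => U hU.
  by have [-> ->] := filter_mem_setU1 U ys.
by have [-> ->] := filter_mem_cons s (notin_subset_seq ys hU).
Qed.

End SubsetSums.

Section PartitionConvolutions.
Variables (K : comNzRingType) (N : nat) (c : {set 'I_N} -> K).
Implicit Types (U S : {set 'I_N}) (s u v : seq 'I_N) (f g m : seq 'I_N -> K).

Lemma decr_trans : transitive (fun i j : 'I_N => (j < i)%N).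
Proof. by move=> j i k /= ji kj; exact: ltn_trans kj ji. Qed.

Lemma decr_uniq s : decr s -> uniq s.
Proof. by apply: sorted_uniq => [|i]; [exact: decr_trans|rewrite ltnn]. Qed.

Lemma decr_cons (y : 'I_N) s :
  decr (y :: s) = [forall i : 'I_N, (i \in s) ==> (i < y)%N] && decr s.
Proof.
rewrite /decr /= path_sortedE; last exact: decr_trans.
congr (_ && _); apply/allP/forall_inP => h i si; exact: h.
Qed.

Lemma decr_lt (y i : 'I_N) s : decr (y :: s) -> i \in s -> (i < y)%N.
Proof. by rewrite decr_cons => /andP[/forall_inP h _] /h. Qed.

Lemma decr_filter a s : decr s -> decr [seq i <- s | a i].
Proof. by apply: sorted_filter; exact: decr_trans. Qed.

(** In a decreasing list the prefixes are exactly the upper sets. *)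
Lemma cut_conv_subsets f g s : decr s ->
  cut_conv f g s = \sum_(U : {set 'I_N} | (U \subset [set i in s]) && upper U [set i in s])
    f [seq i <- s | i \in U] * g [seq i <- s | i \notin U].
Proof.
elim: s f => [|y s IH] f.
  rewrite cut_conv_nil => _; rewrite (big_pred1 set0) // => U; rewrite subset_seq_nil.
  apply/andP/eqP => [[/eqP ->] //|->]; split=> //.
  by apply/upperP => a b; rewrite inE.
move=> hs; have us := decr_uniq hs; have /andP[ys us'] := us.
have ds : decr s by move: hs; rewrite decr_cons => /andP[].
rewrite cut_conv_cons [RHS]big_mkcondr set_cons sum_subset_setU1 ?inE // addrC; congr (_ + _).
  rewrite IH // big_mkcondr; apply: eq_bigr => U hU.
  have [-> ->] := filter_mem_setU1 U ys; rewrite /shift.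
  congr (if _ then _ else _); apply/upperP/upperP => h a b.
    rewrite !inE => /orP[/eqP ->|aU] /orP[/eqP -> _|bs ab]; rewrite ?eqxx //.
      by have := decr_lt hs bs; rewrite ltnNge (ltnW ab).
    by rewrite (h a b) ?orbT // inE.
  rewrite inE => aU bs ab; have := h a b; rewrite !inE aU bs !orbT => /(_ erefl erefl ab).
  by case: eqP => // yb; move: ys; rewrite -yb bs.
rewrite (bigD1 set0) ?sub0set //= [X in _ + X]big1 ?addr0; last first.
  move=> U /andP[hU U0]; case: upperP => // h; case/set0Pn: U0 => a aU.
  have as' : a \in s by have := subsetP hU a aU; rewrite inE.
  have := h a y aU (setU11 _ _) (decr_lt hs as').
  by rewrite (negPf (notin_subset_seq ys hU)).
have /= [-> ->] := filter_mem_cons s (negbT (in_set0 y)).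
rewrite (_ : upper _ _); last by apply/upperP => a b; rewrite inE.
congr (f _ * g (y :: _)).
  by rewrite (eq_filter (a2 := pred0)) ?filter_pred0 // => i; rewrite inE.
by rewrite (eq_filter (a2 := predT)) ?filter_predT // => i; rewrite inE.
Qed.

(* [acc] is the part of the current gap that has already been read. *)
Lemma gap_conv_subsets m f g acc s :
  (forall v, decr v -> m v = nc_sum c [set i in v]) ->
  (forall v, decr (acc ++ v) -> g v = nc_sum c [set i in acc ++ v]) ->
  decr (acc ++ s) ->
  gap_conv m f g s = \sum_(U : {set 'I_N} | U \subset [set i in s])
    f [seq i <- s | i \in U]
    * partition_sum c (noncrossing_around U) ([set i in s] :\: U :|: [set i in acc]).
Proof.
move=> mE; elim: s f g acc => [|y s IH] f g acc gE ds /=.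
  rewrite (big_pred1 set0) => [|U]; last by rewrite subset_seq_nil.
  rewrite gE //; congr (_ * _); rewrite cats0 setD0 (_ : [set i in [::]] = set0); last first.
    by apply/setP => i; rewrite !inE.
  rewrite set0U; apply: eq_bigl => P; congr (_ && _); rewrite /noncrossing_around.
  by rewrite [X in _ && X](_ : _ = true) ?andbT //; apply/forall_inP => V _; apply/unseparatedP => u a b; rewrite inE.
have dys : decr (y :: s) by move: ds; rewrite /decr => /(subseq_sorted decr_trans (suffix_subseq acc (y :: s))).
have ds' : decr s by move: dys; rewrite decr_cons => /andP[].
have /andP[ys us] := decr_uniq dys.
have dacc : decr acc by move: ds; rewrite /decr => /(subseq_sorted decr_trans (prefix_subseq acc (y :: s))).
have accy i : i \in acc -> (y < i)%N.
  move: ds; rewrite /decr (sorted_pairwise decr_trans) pairwise_cat => /andP[/allrelP h _] ia.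
  by apply: h; rewrite ?inE ?eqxx.
(* If [y] is selected, it separates the finished gap [acc] above it from the positions of [s] below
   it, and a new empty gap starts. If not, [y] joins [acc]. *)
rewrite set_cons sum_subset_setU1 ?inE //; congr (_ + _).
  rewrite (IH _ m [::]) // mulr_sumr; apply: eq_bigr => U hU.
  have /= [-> _] := filter_mem_setU1 U ys; rewrite /shift gE ?cats0 //.
  rewrite (_ : (y |: [set i in s]) :\: (y |: U) = [set i in s] :\: U); last first.
    apply/setP => i; rewrite !inE; case: eqP => [->|] //=.
    by rewrite (negPf ys) andbF.
  rewrite noncrossing_around_sum_split.
  - rewrite (_ : [set i in [::]] = set0) ?setU0; first by ring.
    by apply/setP => i; rewrite !inE.
  - by move=> d /(subsetP hU); rewrite inE; exact: decr_lt dys.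
  - by move=> d; rewrite !inE => /andP[_]; exact: decr_lt dys.
  - by move=> d; rewrite inE; exact: accy.
rewrite (IH _ _ (rcons acc y)) ?cat_rcons //; last first.
  by move=> v hv; rewrite /shift gE -?cat_rcons.
apply: eq_bigr => U hU; have yU := notin_subset_seq ys hU.
have /= [-> _] := filter_mem_cons s yU; congr (_ * partition_sum _ _ _).
apply/setP => i; rewrite !inE mem_rcons inE.
by case: eqP => [->|] //=; rewrite ?yU ?orbT.
Qed.

End PartitionConvolutions.

(** * Peeling off the block of the last position *)

Section PartitionRecursions.
Variables (K : comNzRingType) (N : nat) (c : {set 'I_N} -> K).
Variables (y : 'I_N) (s : seq 'I_N).
Hypothesis ys_decr : decr (y :: s).

Lemma partition_sum_cons ok : partition_sum c ok [set i in y :: s]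
  = \sum_(U : {set 'I_N} | U \subset [set i in s]) c [set i in y :: [seq i <- s | i \in U]]
      * partition_sum c (fun Q => ok ((y |: U) |: Q)) ([set i in s] :\: U).
Proof.
have /andP[ys us] := decr_uniq ys_decr.
rewrite (partition_sum_block _ _ (x := y)) ?inE ?eqxx // set_cons sum_subset_mem ?inE //.
apply: eq_bigr => U /subsetP hU.
have -> : [set i in y :: [seq i <- s | i \in U]] = y |: U.
  apply/setP => i; rewrite !inE mem_filter; case: eqP => //= _; case iU: (i \in U) => //=.
  by have := hU i iU; rewrite inE.
congr (_ * partition_sum _ _ _); apply/setP => i.
by rewrite !inE; case: eqP => [->|] //=; rewrite (negPf ys) andbF.
Qed.

Lemma set_filter_notin (U : {set 'I_N}) :
  [set i in [seq i <- s | i \notin U]] = [set i in s] :\: U :> {set 'I_N}.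
Proof. by apply/setP => i; rewrite !inE mem_filter. Qed.

Variables k m : seq 'I_N -> K.
Hypothesis kE : forall u, decr (y :: u) -> k u = c [set i in y :: u].

Lemma decr_cons_filter a : decr (y :: [seq i <- s | a i]).
Proof.
move: ys_decr; rewrite !decr_cons => /andP[/forall_inP h /(decr_filter a) ->].
by rewrite andbT; apply/forall_inP => i; rewrite mem_filter => /andP[_ /h].
Qed.

Lemma all_partition_sum_cons :
  (forall v, decr v -> m v = partition_sum c predT [set i in v]) ->
  partition_sum c predT [set i in y :: s] = shuffle_conv k m s.
Proof.
move=> mE; have ds : decr s by move: ys_decr; rewrite decr_cons => /andP[].
have /andP[_ us] := decr_uniq ys_decr.
rewrite partition_sum_cons shuffle_conv_subsets //.
apply: eq_bigr => U _; rewrite kE ?decr_cons_filter // mE ?decr_filter //.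
by rewrite set_filter_notin.
Qed.

Lemma nc_sum_cons :
  (forall v, decr v -> m v = nc_sum c [set i in v]) ->
  nc_sum c [set i in y :: s] = gap_conv m k m s.
Proof.
move=> mE; have ds : decr s by move: ys_decr; rewrite decr_cons => /andP[].
rewrite (gap_conv_subsets (c := c) _ (acc := [::])) // /nc_sum partition_sum_cons.
apply: eq_bigr => U hU; rewrite kE ?decr_cons_filter //; congr (_ * _).
rewrite (_ : [set i in [::]] = set0) ?setU0; last by apply/setP => i; rewrite !inE.
have yU := notin_subset_seq (proj1 (andP (decr_uniq ys_decr))) hU.
rewrite (@eq_partition_sum _ _ _ _ (noncrossing_around (y |: U))); last first.
  move=> Q hQ; apply: (@noncrossing_setU1 _ _ ([set i in s] :\: U) _ y) => //.
  - exact: setU11.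
  - rewrite -setI_eq0; apply/eqP/setP => i; rewrite !inE; case: eqP => [->|_] /=.
      by have /andP[/negPf -> _] := decr_uniq ys_decr; rewrite andbF.
    by case: (i \in U).
  - by move=> d; rewrite !inE => /andP[_]; exact: decr_lt ys_decr.
(* Nothing lies above [y]; splitting there with an empty upper side removes [y] from the block. *)
have := @noncrossing_around_sum_split _ _ c y U ([set i in s] :\: U) set0.
rewrite setU0 => ->; first by rewrite /nc_sum partition_sum0 ?mulr1 //; apply/noncrossingP => A B a b d e; rewrite inE.
- by move=> d /(subsetP hU); rewrite inE; exact: decr_lt ys_decr.
- by move=> d; rewrite !inE => /andP[_]; exact: decr_lt ys_decr.
- by move=> d; rewrite inE.
Qed.

Definition interval_sum (S : {set 'I_N}) := partition_sum c (interval_in S) S.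

Lemma interval_sum_cons :
  (forall v, decr v -> m v = interval_sum [set i in v]) ->
  interval_sum [set i in y :: s] = cut_conv k m s.
Proof.
move=> mE.
have /andP[ys us] := decr_uniq ys_decr.
have ds : decr s by move: ys_decr; rewrite decr_cons => /andP[].
rewrite {1}/interval_sum partition_sum_cons cut_conv_subsets // [RHS]big_mkcondr.
apply: eq_bigr => U hU; rewrite kE ?decr_cons_filter // mE ?decr_filter // set_filter_notin.
have SE : [set i in y :: s] :\: (y |: U) = [set i in s] :\: U.
  by apply/setP => i; rewrite !inE; case: eqP => [->|] //=; rewrite (negPf ys) andbF.
(* No position exceeds [y], and [y] belongs to the enlarged block, so pairs involving [y] impose
   nothing. *)
have upE : upper (y |: U) [set i in y :: s] = upper U [set i in s].
  apply/upperP/upperP => h a b; last first.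
    rewrite !inE => /orP[/eqP ->|aU] /orP[/eqP -> _|bs ab]; rewrite ?eqxx //.
      by have := decr_lt ys_decr bs; rewrite ltnNge (ltnW ab).
    by rewrite (h a b) ?orbT // inE.
  rewrite inE => aU bs ab; have := h a b; rewrite !inE aU bs !orbT => /(_ erefl erefl ab).
  by case: eqP => // yb; move: ys; rewrite -yb bs.
rewrite -[X in partition_sum c _ X]SE.
rewrite (@eq_partition_sum _ _ _ _ (fun Q => upper U [set i in s] && interval_in ([set i in s] :\: U) Q)); last first.
  move=> Q; rewrite {1}SE => hQ; rewrite (@interval_in_setU1 _ (y |: U) _ _ y) ?setU11 ?upE ?SE //.
    by rewrite set_cons setUS.
  by move=> d; rewrite !inE => /orP[/eqP -> //|/(decr_lt ys_decr)/ltnW].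
rewrite SE /interval_sum; case: (upper U [set i in s]) => //.
by rewrite /partition_sum big_pred0 ?mulr0 // => P; rewrite andbF.
Qed.

End PartitionRecursions.

(** * Moment-cumulant relations on subsets of one ordinal *)

Section Transport.
Variables (K : comNzRingType) (A : algType K) (phi : A -> K) (C : seq A -> K).
Hypothesis phi1 : phi 1 = 1.
Variables (N : nat) (X : 'I_N -> A).
Let c (U : {set 'I_N}) := C [seq X u | u in U].

Lemma sorted_enum_ord n (U : {set 'I_n}) : sorted (fun i j : 'I_n => (i < j)%N) (enum U).
Proof.
rewrite /enum_mem -enumT; apply: sorted_filter => [j i k|]; first exact: ltn_trans.
by have := iota_ltn_sorted 0 n; rewrite -val_enum_ord sorted_map.
Qed.

Lemma enum_ord_decr (v : seq 'I_N) : decr v -> enum [set i in v] = rev v.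
Proof.
move=> dv; apply: (irr_sorted_eq (leT := fun i j : 'I_N => (i < j)%N)).
- by move=> j i k; exact: ltn_trans.
- by move=> i /=; rewrite ltnn.
- exact: sorted_enum_ord.
- by rewrite rev_sorted.
- by move=> i; rewrite mem_enum inE mem_rev.
Qed.

Lemma enum_val_ltn (S : {set 'I_N}) : {mono @enum_val _ (mem S) : i j / (i < j)%N}.
Proof.
have mono (i j : 'I_#|S|) : (i < j)%N -> (enum_val i < enum_val j)%N.
  move=> ij; have x0 := enum_val i; rewrite !(enum_val_nth x0).
  apply: (sorted_ltn_nth (leT := fun i j : 'I_N => (i < j)%N)) => //; rewrite ?inE -?cardE //.
  - by move=> a b d; exact: ltn_trans.
  - exact: sorted_enum_ord.
move=> i j; apply/idP/idP => [h|]; last exact: mono.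
case: (ltngtP i j) => // [/mono /(ltn_trans h)|/val_inj ij].
  by rewrite ltnn.
by rewrite ij ltnn in h.
Qed.

Lemma enum_imset_val (S : {set 'I_N}) (U : {set 'I_#|S|}) :
  enum (enum_val @: U) = [seq enum_val u | u <- enum U].
Proof.
apply: (irr_sorted_eq (leT := fun i j : 'I_N => (i < j)%N)).
- by move=> j i k; exact: ltn_trans.
- by move=> i /=; rewrite ltnn.
- exact: sorted_enum_ord.
- rewrite sorted_map; apply: sub_sorted (sorted_enum_ord U) => i j /=.
  by rewrite enum_val_ltn.
- move=> i; rewrite mem_enum; apply/imsetP/mapP => -[u hu ->]; exists u => //;
    by rewrite mem_enum in hu *.
Qed.

(** The relation for [n = #|S|] concerns partitions of ['I_n]; the increasing enumeration of [S]
    carries them to partitions of [S]. All subwords of a word are thus treated inside one ['I_N]. *)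
Lemma moment_partition_sum adm (ok : pred {set {set 'I_N}}) (S : {set 'I_N}) :
  moment_cumulant_rel phi C adm -> ok set0 ->
  (forall P : {set {set 'I_#|S|}},
     adm #|S| P = ok [set enum_val @: (U : {set 'I_#|S|}) | U in P]) ->
  phi (\prod_(i <- enum S) X i) = partition_sum c ok S.
Proof.
(* The relation starts at [n = 1]; for empty [S] both sides are 1, by [phi1] and the empty
   partition. *)
move=> rel ok0 admE; case: (posnP #|S|) => [/eqP|S0].
  by rewrite cards_eq0 => /eqP ->; rewrite enum_set0 big_nil phi1 partition_sum0.
have SE : enum_val @: [set: 'I_#|S|] = S.
  apply/setP => i; apply/imsetP/idP => [[j _ ->]|iS]; first exact: enum_valP.
  by exists (enum_rank_in iS i); rewrite ?inE // enum_rankK_in.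
rewrite -[in LHS]SE enum_imset_val big_map enum_setT.
have -> : Finite.enum 'I_#|S| = index_enum 'I_#|S| by rewrite [index_enum _]unlock.
rewrite rel // -[in RHS]SE.
rewrite -partition_sum_imset; last exact: enum_val_inj.
apply: eq_big => [P|P _]; first by rewrite admE.
by apply: eq_bigr => U _; rewrite /c /image_mem enum_imset_val -map_comp.
Qed.

Lemma noncrossing_imset (S : {set 'I_N}) (P : {set {set 'I_#|S|}}) :
  noncrossing P = noncrossing [set enum_val @: (U : {set 'I_#|S|}) | U in P].
Proof.
have mE (U : {set 'I_#|S|}) i : (enum_val i \in enum_val @: U) = (i \in U).
  by rewrite mem_imset //; exact: enum_val_inj.
apply/noncrossingP/noncrossingP => h.
  move=> _ _ a b d e /imsetP[U UP ->] /imsetP[V VP ->] UV ab bd de.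
  move=> /imsetP[a' a'U aE] /imsetP[d' d'U dE] /imsetP[b' b'U bE] /imsetP[e' e'U eE].
  rewrite aE bE dE eE !enum_val_ltn in ab bd de.
  by apply: (h U V a' b' d' e') => //; apply: contraNneq UV => ->.
move=> U V a b d e UP VP UV ab bd de aU dU bV eV.
apply: (h (enum_val @: U) (enum_val @: V) (enum_val a) (enum_val b) (enum_val d) (enum_val e));
  rewrite ?enum_val_ltn ?mE ?imset_f //.
by rewrite (inj_eq (imset_inj enum_val_inj)).
Qed.

Lemma interval_partition_imset (S : {set 'I_N}) (P : {set {set 'I_#|S|}}) :
  interval_partition P = interval_in S [set enum_val @: (U : {set 'I_#|S|}) | U in P].
Proof.
have mE (U : {set 'I_#|S|}) i : (enum_val i \in enum_val @: U) = (i \in U).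
  by rewrite mem_imset //; exact: enum_val_inj.
apply/idP/interval_inP => [h|h].
  move=> _ a b d /imsetP[U UP ->] ab bd /imsetP[a' a'U aE] /imsetP[d' d'U dE] bS.
  have := enum_rankK_in bS bS; move: (enum_rank_in bS b) => b' bE.
  rewrite aE dE -bE !enum_val_ltn in ab bd *; rewrite mE.
  move: h => /forall_inP/(_ U UP)/forallP/(_ a')/forallP/(_ b')/forallP/(_ d').
  by rewrite ab bd a'U d'U.
apply/forall_inP => U UP; apply/forallP => a; apply/forallP => b; apply/forallP => d.
apply/implyP => /and4P[ab bd aU dU]; rewrite -mE.
by apply: (h _ (enum_val a) _ (enum_val d));
  rewrite ?enum_val_ltn ?mE ?imset_f //; exact: enum_valP.
Qed.

End Transport.

(** * Recursions for the moments of words *)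

Section WordRecursions.
Variables (K : comNzRingType) (A : algType K) (phi : A -> K) (C : seq A -> K).
Variables (I : Type) (X : I -> A).
Hypothesis phi1 : phi 1 = 1.
Implicit Types (x : I) (w : seq I).

Definition moment w : K := phi (\prod_(i <- rev w) X i).
Definition cumulant x w : K := C [seq X i | i <- rev (x :: w)].

Lemma shuffle_conv_map (J : Type) (h : J -> I) (f g : seq I -> K) v :
  shuffle_conv f g (map h v) = shuffle_conv (f \o map h) (g \o map h) v.
Proof.
elim: v f g => [|j v IH] f g; first by rewrite !shuffle_conv_nil.
by rewrite map_cons !shuffle_conv_cons !IH.
Qed.

Lemma cut_conv_map (J : Type) (h : J -> I) (f g : seq I -> K) v :
  cut_conv f g (map h v) = cut_conv (f \o map h) (g \o map h) v.
Proof.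
elim: v f => [|j v IH] f; first by rewrite !cut_conv_nil.
by rewrite map_cons !cut_conv_cons !IH.
Qed.

Lemma gap_conv_map (J : Type) (h : J -> I) (m f g : seq I -> K) v :
  gap_conv m f g (map h v) = gap_conv (m \o map h) (f \o map h) (g \o map h) v.
Proof. by elim: v f g => [|j v IH] f g //=; rewrite !IH. Qed.

(** Passing to positions makes the letters distinct, and reading them in decreasing order matches
    the reversed words. *)
Lemma ordinal_word x w : exists N (h : 'I_N -> I) (y : 'I_N) (s : seq 'I_N),
  [/\ decr (y :: s), h y = x & map h s = w].
Proof.
pose h (i : 'I_(size w).+1) := nth x (rev (x :: w)) i.
have hE : map h (rev (enum 'I_(size w).+1)) = x :: w.
  rewrite map_rev /h (map_comp (nth x (rev (x :: w))) val) val_enum_ord.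
  by rewrite map_nth_iota0 ?size_rev // -[(size w).+1]/(size (x :: w)) -size_rev take_size revK.
have : decr (rev (enum 'I_(size w).+1)).
  have := iota_ltn_sorted 0 (size w).+1; rewrite -val_enum_ord sorted_map -rev_sorted.
  by [].
case: (rev _) hE => // y s [hy hs] ds.
by exists (size w).+1, h, y, s.
Qed.

Section Positions.
Variables (N : nat) (h : 'I_N -> I).
Let c (U : {set 'I_N}) := C [seq X (h u) | u in U].

Lemma cumulant_positions y u : decr (y :: u) -> cumulant (h y) (map h u) = c [set i in y :: u].
Proof.
by move=> du; rewrite /cumulant -map_cons -map_rev -map_comp /c /image_mem enum_ord_decr.
Qed.

Lemma moment_positions adm (ok : {set 'I_N} -> pred {set {set 'I_N}}) v :
  moment_cumulant_rel phi C adm -> (forall S, ok S set0) ->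
  (forall (S : {set 'I_N}) (P : {set {set 'I_#|S|}}),
     adm #|S| P = ok S [set enum_val @: (U : {set 'I_#|S|}) | U in P]) ->
  decr v -> moment (map h v) = partition_sum c (ok [set i in v]) [set i in v].
Proof.
move=> rel ok0 admE dv.
rewrite -(moment_partition_sum phi1 (X \o h) rel) //.
by rewrite enum_ord_decr // /moment -map_rev big_map.
Qed.

End Positions.

Lemma moment_classical x w : classical_cumulants phi C ->
  moment (x :: w) = shuffle_conv (cumulant x) moment w.
Proof.
move=> rel; have [N [h [y [s [ds <- <-]]]]] := ordinal_word x w.
pose c (U : {set 'I_N}) := C [seq X (h u) | u in U].
have mE v : decr v -> moment (map h v) = partition_sum c predT [set i in v].
  by apply: (@moment_positions _ h _ (fun=> predT) v rel).
rewrite -map_cons mE // shuffle_conv_map.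
by apply: all_partition_sum_cons => // u; exact: cumulant_positions.
Qed.

Lemma moment_free x w : free_cumulants phi C ->
  moment (x :: w) = gap_conv moment (cumulant x) moment w.
Proof.
move=> rel; have [N [h [y [s [ds <- <-]]]]] := ordinal_word x w.
pose c (U : {set 'I_N}) := C [seq X (h u) | u in U].
have mE v : decr v -> moment (map h v) = nc_sum c [set i in v].
  apply: (@moment_positions _ h _ (fun=> @noncrossing N) v rel) => [S|S P].
    by apply/noncrossingP => U V a b d e; rewrite inE.
  exact: noncrossing_imset.
rewrite -map_cons mE // gap_conv_map.
by apply: nc_sum_cons => // u; exact: cumulant_positions.
Qed.

Lemma moment_boolean x w : boolean_cumulants phi C ->
  moment (x :: w) = cut_conv (cumulant x) moment w.
Proof.
move=> rel; have [N [h [y [s [ds <- <-]]]]] := ordinal_word x w.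
pose c (U : {set 'I_N}) := C [seq X (h u) | u in U].
have mE v : decr v -> moment (map h v) = interval_sum c [set i in v].
  apply: (@moment_positions _ h _ (@interval_in N) v rel) => [S|S P].
    by apply/interval_inP => U a b d; rewrite inE.
  exact: interval_partition_imset.
rewrite -map_cons mE // cut_conv_map.
by apply: interval_sum_cons => // u; exact: cumulant_positions.
Qed.

End WordRecursions.

(** * From moments back to cumulants, and the equivalence *)

Section CumulantsContextSum.
Variables (K : comNzRingType) (I : Type) (tau : cbpt I -> K).
Variables (L : (seq I -> K) -> seq I -> K) (trees : seq I -> seq (bptree I)).
Variables (m : seq I -> K) (k : I -> seq I -> K).
Hypothesis tau_troupe : weighted_troupe tau.
Hypothesis m1 : m [::] = 1.
Hypothesis mE : forall x w, m (x :: w) = L (k x) w.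
Hypothesis L_linear : forall a f f' w, L (fun u => a * f u + f' u) w = a * L f w + L f' w.
Hypothesis L_ext : forall f f' w, (forall u, (size u <= size w)%N -> f u = f' u) -> L f w = L f' w.
Hypothesis L_nil : forall f, L f [::] = f [::].
Hypothesis L_unitriangular : unitriangular L.
Hypothesis trees_nil : forall c : bptree I -> K, tree_sum trees c [::] = 0.
Let E := @tree_sum K I trees.
Let Et x := E (fun t => tau (t, x)).
Hypothesis L_tree_sum : forall c x w, troupe_context tau c ->
  (forall v, (size v <= size w)%N -> m (x :: v) = - L (Et x) v) ->
  L (E c) (x :: w) = c (leaf x) * m w + L (E (fun t => c (BNode t x BLeaf))) w
    + L (E (fun t => c (BNode BLeaf x t))) w.

(** Both [L (k x)] and [- L (Et x)] give the moments, and a unitriangular linear map is injective;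
    hence equality of moments passes back to the cumulants. *)
Lemma cumulants_context_sum :
  (forall x w, - k x w = Et x w) <-> (forall w, m w = context_sum tau 1 (fun=> 0) w).
Proof.
rewrite -(moments_context_sum tau_troupe m1 L_linear L_ext L_nil trees_nil L_tree_sum) -/Et.
have LN f w : L (fun u => - f u) w = - L f w.
  have L0 : L (fun=> 0) w = 0.
    have := L_linear (-1) (fun=> 0) (fun=> 0) w.
    by rewrite (L_ext (f' := fun=> 0)) => [->|u _]; ring.
  rewrite (L_ext (f' := fun u => -1 * f u + 0)) => [|u _]; last by ring.
  by rewrite L_linear L0; ring.
split=> [H x w|H x w].
  by rewrite mE -LN; apply: L_ext => u _; rewrite -[k x u]opprK H.
have [n hn] := ubnP (size w); elim: n w hn => // n IH w hn.
(* By induction [k x] and [- Et x] agree on shorter words, so their images under [L] differ at [w]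
   by [k x w + Et x w], which must vanish. *)
have := H x w; rewrite mE -LN (L_unitriangular (f' := fun u => - Et x u)) => [|u hu].
  by move=> /eqP; rewrite -subr_eq0 addrAC subrr add0r opprK addr_eq0 => /eqP ->; rewrite opprK.
by rewrite -IH ?opprK //; exact: leq_trans hu hn.
Qed.

End CumulantsContextSum.

Theorem theorem4p1 (K : comNzRingType) (A : algType K) (phi : A -> K)
  (I : Type) (X : I -> A) (tau : cbpt I -> K) (Kc Rc Bc : seq A -> K) :
  (forall (a : K) (x y : A), phi (a *: x + y) = a * phi x + phi y) ->
  phi 1 = 1 ->
  classical_cumulants phi Kc ->
  free_cumulants phi Rc ->
  boolean_cumulants phi Bc ->
  weighted_troupe tau ->
  [<-> (forall (s : seq I) (j : I),
          - Kc [seq X i | i <- rcons s j] = sum_DBPT tau s j);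
       (forall (s : seq I) (j : I),
          - Rc [seq X i | i <- rcons s j] = sum_BPT tau s j);
       (forall (s : seq I) (j : I),
          - Bc [seq X i | i <- rcons s j] = sum_Branch tau s j)].
Proof.
move=> _ phi1 hK hR hB tauP.
pose m := moment phi X.
have m1 : m [::] = 1 by rewrite /m /moment big_nil.
pose M := forall w, m w = context_sum tau 1 (fun=> 0) w.
have wordsE C (trees : seq I -> seq (bptree I)) (F : seq I -> I -> K) :
    (forall s j, F s j = tree_sum trees (fun t => tau (t, j)) (rev s)) ->
    (forall s j, - C [seq X i | i <- rcons s j] = F s j) <->
    (forall x w, - cumulant C X x w = tree_sum trees (fun t => tau (t, x)) w).
  move=> FE; split=> [H x w|H s j].
    by rewrite /cumulant rev_cons H FE revK.
  by rewrite FE -H /cumulant rev_cons revK.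
have tree_sumE (trees : seq I -> seq (bptree I)) (s : seq I) j :
    \sum_(t <- trees s) tau (t, j) = tree_sum trees (fun t => tau (t, j)) s.
  (* Only the empty tree is left out on the right, and a troupe is 0 there. *)
  rewrite /tree_sum [RHS]big_mkcond; apply: eq_bigr => -[|l x r] _ //=.
  exact: (proj1 tauP).
have iffK : (forall s j, - Kc [seq X i | i <- rcons s j] = sum_DBPT tau s j) <-> M.
  rewrite (wordsE _ (fun w => split_trees (size w) w)) => [|s j]; last first.
    by rewrite sum_DBPT_split_trees (tree_sumE (fun w => split_trees (size w) w)).
  have rP := split_trees_root_recursive K I.
  apply: (cumulants_context_sum (L := fun f => shuffle_conv f m)) => //.
  - by move=> x w; exact: moment_classical.
  - by move=> *; exact: shuffle_conv_linearl.
  - by move=> f f' w ef; exact: eq_shuffle_conv.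
  - by move=> f; rewrite shuffle_conv_nil m1 mulr1.
  - exact: shuffle_conv_unitriangular.
  - by move=> c; exact: tree_sum_nil rP _.
  - by move=> c x w cc H; exact: shuffle_conv_tree_sum rP cc H.
have rP := bpts_root_recursive K I.
have iffR : (forall s j, - Rc [seq X i | i <- rcons s j] = sum_BPT tau s j) <-> M.
  rewrite (wordsE _ (fun w => bpts (rev w))) => [|s j]; last first.
    by rewrite -(tree_sumE (fun w => bpts (rev w))) revK.
  apply: (cumulants_context_sum (L := fun f => gap_conv m f m)) => //.
  - by move=> x w; exact: moment_free.
  - by move=> *; exact: gap_conv_linearl.
  - by move=> f f' w ef; exact: eq_gap_conv.
  - by move=> f /=; rewrite m1 mulr1.
  - exact: gap_conv_unitriangular.
  - by move=> c; exact: tree_sum_nil rP _.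
  - by move=> c x w cc H; exact: gap_conv_tree_sum m1 rP cc H.
have iffB : (forall s j, - Bc [seq X i | i <- rcons s j] = sum_Branch tau s j) <-> M.
  pose branches w := [seq t <- bpts (rev w) | @chain I t].
  rewrite (wordsE _ branches) => [|s j]; last first.
    rewrite /tree_sum /branches revK big_filter_cond /sum_Branch.
    by apply: eq_bigl => t; rewrite andbC.
  apply: (cumulants_context_sum (L := fun f => cut_conv f m)) => //.
  - by move=> x w; exact: moment_boolean.
  - by move=> *; exact: cut_conv_linearl.
  - by move=> f f' w ef; exact: eq_cut_conv.
  - by move=> f; rewrite cut_conv_nil m1 mulr1.
  - exact: cut_conv_unitriangular.
  - by move=> c; rewrite /tree_sum /branches big_filter_cond big_mkcond big_seq1.
  - by move=> c x w _ _; exact: cut_conv_chain_sum rP.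
by tfae; [move=> /iffK/iffR|move=> /iffR/iffB|move=> /iffB/iffK].
Qed.
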